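(* Let $G=([n],E)$ be a simple undirected graph on $n\in\mathbb{N}$ vertices with $m:=|E|\geq 1$ edges and adjacency matrix $(a_{i,j})_{1\le i,j\le n}$, and let $c\geq2$ be an integer. Let $X_1,\dotsc,X_n$ be independent random variables, each uniformly distributed on $[c]=\{1,\dotsc,c\}$, let $$T_2(G):=\sum_{1\leq i<j\leq n}a_{i,j}\mathbf{1}_{\{X_i=X_j\}}$$ be the number of monochromatic edges, and let $F:=\bigl(T_2(G)-\mathbb{E}[T_2(G)]\bigr)/\sqrt{\operatorname{Var}(T_2(G))}$. Then, for $Z\sim N(0,1)$, $$d_{\mathcal W}(F,Z)\leq \sqrt{\frac{2}{\pi}}\biggl(\frac{3(c-2)}{m}+\frac{10\sqrt{2}}{m^{1/2}}+\frac{15\sqrt{2}}{m^{1/2}(c-1)}+\frac{30\,N(C_4,G)}{m^2(c-1)}\biggr)^{1/2}+\sqrt{2}\biggl(\frac{c-1}{m}+\frac{5\sqrt{2}}{m^{1/2}(c-1)}+\frac{7\sqrt{2}}{m^{1/2}}\biggr)^{1/2}.$$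
   Context: $[n]=\{1,\dotsc,n\}$; $a_{i,j}=1$ if $\{i,j\}\in E$ and $a_{i,j}=0$ otherwise. $N(C_4,G)$ denotes the number of (not necessarily induced) copies of the $4$-cycle in $G$, i.e. $$N(C_4,G)=\frac18\sum a_{i,j}a_{j,k}a_{k,l}a_{l,i},$$ where the sum runs over all $(i,j,k,l)\in[n]^4$ with pairwise distinct entries. The Wasserstein distance between integrable real random variables is $d_{\mathcal W}(Y,W)=\sup_h|\mathbb{E}[h(Y)]-\mathbb{E}[h(W)]|$, the supremum being over all Lipschitz functions $h:\mathbb{R}\to\mathbb{R}$ with Lipschitz constant $1$. *)

(* Defs.v *)
From HB Require Import structures.
From mathcomp Require Import all_boot all_order all_algebra.
From mathcomp Require Import all_classical all_reals all_analysis.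

Set Implicit Arguments.
Unset Strict Implicit.
Unset Printing Implicit Defensive.

Import Order.TTheory GRing.Theory Num.Theory.
Import numFieldNormedType.Exports.

Local Open Scope classical_set_scope.
Local Open Scope ring_scope.

(* A simple undirected graph on [n] is given by its edge set [E], a set of
   two-element subsets of ['I_n]; the vertex [i : 'I_n] stands for
   [i + 1] in {1, ..., n}. *)
Definition simple_edges (n : nat) (E : {set {set 'I_n}}) : Prop :=
  forall e, e \in E -> #|e| = 2%N.

(* For [i = j] the set [[set i; j]] is a singleton, so the diagonal is zero as
   soon as [simple_edges E] holds. *)
Definition adj (R : realType) (n : nat) (E : {set {set 'I_n}}) (i j : 'I_n) : R :=
  ([set i; j]%SET \in E)%:R.

Definition C4_copies (R : realType) (n : nat) (E : {set {set 'I_n}}) : R :=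
  8^-1 * \sum_(i < n) \sum_(j < n) \sum_(k < n)
           \sum_(l < n | uniq [:: i; j; k; l])
             adj R E i j * adj R E j k * adj R E k l * adj R E l i.

Definition mutually_independent d d' (T : measurableType d)
    (T' : measurableType d') (R : realType) (P : probability T R)
    (I : finType) (X : I -> {RV P >-> T'}) : Prop :=
  forall (J : {set I}) (B : I -> set T'), (forall i, measurable (B i)) ->
  P [set w | forall i, i \in J -> B i (X i w)] =
  (\prod_(i in J) P (X i @^-1` B i))%E.

Definition uniform_on_1_to d (T : measurableType d) (R : realType)
    (P : probability T R) (c : nat) (X : {RV P >-> nat}) : Prop :=
  forall k : nat, distribution P X [set k] =
    (if (1 <= k <= c)%N then c%:R^-1 else 0)%:E.

(* Only measurable sets are tested, the values of measures on the other sets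
   being meaningless. The second parameter of [normal_prob] is the standard
   deviation. *)
Definition standard_normal d (T : measurableType d) (R : realType)
    (P : probability T R) (Z : {RV P >-> R}) : Prop :=
  forall A : set R, measurable A -> distribution P Z A = normal_prob 0 1 A.

Definition monochromatic_edges (R : realType) (n : nat) (E : {set {set 'I_n}})
    (T : Type) (X : 'I_n -> T -> nat) (w : T) : R :=
  \sum_(i < n) \sum_(j < n | (i < j)%N) adj R E i j * (X i w == X j w)%:R.

Definition standardize d (T : measurableType d) (R : realType)
    (P : probability T R) (Y : T -> R) (w : T) : R :=
  (Y w - fine 'E_P[Y]) / Num.sqrt (fine 'V_P[Y]).

(* The two random variables may live on different probability spaces: only their
   laws matter. The definition is meaningful for integrable [Y] and [W]. *)
Definition wasserstein d1 d2 (T1 : measurableType d1) (T2 : measurableType d2)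
    (R : realType) (P : probability T1 R) (Q : probability T2 R)
    (Y : T1 -> R) (W : T2 -> R) : \bar R :=
  ereal_sup [set `| 'E_P[h \o Y] - 'E_Q[h \o W] |%E
            | h in [set h : R -> R | 1.-lipschitz h]].

(* Main.v *)
Require Import Defs.
From HB Require Import structures.
From mathcomp Require Import all_boot all_order all_algebra.
From mathcomp Require Import all_classical all_reals all_analysis.
From mathcomp Require Import measurable_realfun.
From mathcomp Require Import ring lra.
Set Implicit Arguments.
Unset Strict Implicit.
Unset Printing Implicit Defensive.
Import Order.TTheory GRing.Theory Num.Theory.
Import numFieldNormedType.Exports.
Local Open Scope classical_set_scope.
Local Open Scope ring_scope.

(** Let [W i j] be the indicator that the vertices i and j get the same color, minus 1/c, and
    let v be its variance. With uniform colors, redrawing the color of j averages [W i j] to 0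
    and [W i j * W j k] to [W i k / c] ([resample_cmatchr], [resample_cherry]); these two
    facts carry the variance computations. The standardized count F is the sum of [W] over the
    edges, divided by s with s^2 = v m.

    Stein's method with an exchangeable pair would redraw the color of one vertex j and use the
    sum of [W] over all edges at j twice. This brings in the sum of the squared degrees, which
    a star makes as large as m^2. Instead, direct every edge from its endpoint of larger degree
    to the other one and let U_j be the sum of [W] over the edges that enter j. Then F is the
    sum of the U_j / s, and since U_j averages to 0 over the color of j, the identity
    E U_j f(F) = E (U_j - U_j') (f(F) - f(F')) / 2 holds with primes for the redrawn coloring,
    although F changes by the contribution of all edges at j ([exchange_stein]). The first
    increment sees in-degrees only. In-degrees are at most r = sqrt (2 m) because the
    in-neighbors of j have degree at least that of j ([indeg_orient]), so the sum over j of
    in-degree times degree is at most 2 r m ([sum_indeg_deg]). This is the origin of all terms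
    of order m^(-1/2).

    For a 1-Lipschitz h, Stein's equation f' x - x f x = h x - E h(Z) has a solution for which
    |f'| <= 5/4 sqrt (2 / pi) and f' is 2-Lipschitz ([stein_solution]). Together with the
    trapezoidal rule this bounds the distance by 5/4 sqrt (2 / pi) times the standard deviation
    of the random variable S given by [carre_du_champ], which has mean 1, plus a multiple of the
    square root of a fourth moment ([stein_pair_bound]). The fourth moment is computed from the
    conditional independence of the increments at distinct neighbors ([mean_mdiff_forms_le]).

    The variance of S is read off an orthogonal decomposition ([carre_du_champ_expand]). S is
    built from products [W i j * W j k]. For i = k these are squares, affine in [W i j] with a
    slope proportional to c - 2. For i <> k such a product is [W i k / c] plus a kernel of three
    vertices whose conditional mean vanishes in each of them. The kernels are orthogonal for
    different triples and orthogonal to every [W] ([mean_form3_sqr_le], [mean_degen3_cmatch]);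
    the [W] are orthogonal for different pairs ([mean_form2_sqr]). The coefficient of [W i k]
    is a weighted number of common neighbors of i and k, and the sum of the squares of these
    numbers counts the 4-cycles ([sum_n_cherry_sqr]). *)

(** * Derivatives and antiderivatives on the real line *)

Section calculus.
Variable R : realType.
Implicit Types (u v : R -> R) (x : R).

Lemma is_derive_add u v du dv x : is_derive x 1 u du -> is_derive x 1 v dv ->
  is_derive x 1 (fun t => u t + v t) (du + dv).
Proof. exact: is_deriveD. Qed.

Lemma is_derive_mul u v du dv x : is_derive x 1 u du -> is_derive x 1 v dv ->
  is_derive x 1 (fun t => u t * v t) (u x * dv + v x * du).
Proof. exact: is_deriveM. Qed.

Lemma is_derive_idf x : is_derive x 1 (fun t => t) 1.
Proof. exact: is_derive_id. Qed.

Lemma is_derive_const a x : is_derive x 1 (fun t : R => a : R) 0.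
Proof. exact: is_derive_cst. Qed.

Lemma is_derive_neg u du x : is_derive x 1 u du -> is_derive x 1 (fun t => - u t) (- du).
Proof. exact: is_deriveN. Qed.

Lemma is_derive_compf u v du dv x : is_derive (v x) 1 u du -> is_derive x 1 v dv ->
  is_derive x 1 (fun t => u (v t)) (du * dv).
Proof. exact: is_derive1_comp. Qed.

Lemma le_of_derive_le0 (u du : R -> R) (a y : R) : (forall t : R, is_derive t 1 u (du t)) ->
  a <= y -> (forall t, a <= t <= y -> du t <= 0) -> u y <= u a.
Proof.
move=> H ay Hle.
have [|c cab E] := @MVT_segment R u du a y ay.
- by apply: derivable_within_continuous => t _; exact: ex_derive.
- rewrite -subr_le0 E; apply: mulr_le0_ge0; rewrite ?subr_ge0 //.
  by apply: Hle; move: cab; rewrite in_itv.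
Qed.

(** Replaces comparisons of tail integrals: two functions with the same limit at
    infinity compare at [a] as soon as their derivatives compare beyond [a]. *)
Lemma ge0_of_cvgy0 (u du : R -> R) (a : R) : (forall t : R, is_derive t 1 u (du t)) ->
  u x @[x --> +oo%R] --> (0:R) -> (forall t, a <= t -> du t <= 0) -> 0 <= u a.
Proof.
move=> H L Hle; apply: (cvgr_to_le L).
near=> y; apply: (le_of_derive_le0 H).
  by near: y; apply: nbhs_pinfty_ge; exact: num_real.
by move=> t /andP[? _]; exact: Hle.
Unshelve. all: by end_near. Qed.

Lemma ge0_of_cvgNy0 (u du : R -> R) (a : R) : (forall t : R, is_derive t 1 u (du t)) ->
  u x @[x --> -oo%R] --> (0:R) -> (forall t, t <= a -> 0 <= du t) -> 0 <= u a.
Proof.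
move=> H L Hle; have D (t : R) : is_derive t 1 (fun t => u (- t)) (du (- t) * -1).
  by apply: (@is_derive_compf u (fun t => - t)) => //; apply: is_derive_neg; exact: is_derive_idf.
rewrite -(opprK a); apply: (ge0_of_cvgy0 D).
- exact/cvgNy_compNP.
- by move=> t ta; rewrite mulrN1 oppr_le0; apply: Hle; rewrite lerNl.
Qed.

Notation mu := (@lebesgue_measure R).

Lemma cvg_antiderivativey (g : R -> R) : mu.-integrable setT (EFin \o g) ->
  \int[mu]_(t in `]-oo, x]) g t @[x --> +oo%R] --> \int[mu]_t g t.
Proof.
move=> ig; have mg := measurable_int _ ig.
apply/cvg_pinftyP => u uoo.
have H : (\int[mu]_(t in `]-oo, u n]) (g t)%:E)%E @[n --> \oo] --> (\int[mu]_t (g t)%:E)%E.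
  under eq_fun do rewrite integral_mkcond.
  apply: (@dominated_cvg _ _ _ mu setT _ _ _ (fun t => (`|g t|%R)%:E)) => //.
  - move=> n; rewrite epatch_indic; apply: emeasurable_funM => //;
      exact/measurable_EFinP/measurable_indic.
  - move=> t _; apply: cvg_near_cst.
    have H := (cvgryPge _).1 uoo t; case: H => N _ HN; exists N => //= n Nn;
      have tn : t <= u n := HN n Nn.
    by rewrite patchE mem_set//= in_itv.
  - exact: (integrable_abse ig).
  - move=> n t _; rewrite patchE; case: ifPn => // _.
    by rewrite abse0 lee_fin.
apply: fine_cvg; rewrite fineK //.
by apply: integrable_fin_num.
Unshelve. all: by end_near. Qed.

Lemma cvg_antiderivativeNy (g : R -> R) : mu.-integrable setT (EFin \o g) ->
  \int[mu]_(t in `]-oo, x]) g t @[x --> -oo%R] --> (0:R).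
Proof.
move=> ig; have mg := measurable_int _ ig.
apply/cvg_ninftyP => u uoo.
have H : (\int[mu]_(t in `]-oo, u n]) (g t)%:E)%E @[n --> \oo] --> (\int[mu]_t (cst 0%E) t)%E.
  under eq_fun do rewrite integral_mkcond.
  apply: (@dominated_cvg _ _ _ mu setT _ _ _ (fun t => (`|g t|%R)%:E)) => //.
  - move=> n; rewrite epatch_indic; apply: emeasurable_funM => //;
      exact/measurable_EFinP/measurable_indic.
  - move=> t _; apply: cvg_near_cst.
    have H := (cvgrNyPlt _).1 uoo t; case: H => N _ HN; exists N => //= n Nn;
      have tn : u n < t := HN n Nn.
    by rewrite patchE memNset//= in_itv/= leNgt tn.
  - exact: (integrable_abse ig).
  - move=> n t _; rewrite patchE; case: ifPn => // _.
    by rewrite abse0 lee_fin.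
by apply: fine_cvg; rewrite integral0 in H.
Unshelve. all: by end_near. Qed.

Lemma is_derive_antiderivative (g : R -> R) (x : R) :
  mu.-integrable setT (EFin \o g) -> continuous g ->
  is_derive x 1 (fun x => \int[mu]_(t in `]-oo, x]) g t) (g x).
Proof.
move=> ig cg.
have xx1 : x < x + 1 by rewrite ltrDl.
have ig' : mu.-integrable `]-oo, x + 1] (EFin \o g) by exact: integrableS ig.
have [d e] := @continuous_FTC1 R g -oo%O x (x + 1) xx1 ig' (ltNyr x) (cg x).
rewrite -[g x]e derive1E; exact/derivableP.
Qed.
End calculus.

(** * The normal density and the Mills ratio *)

Section normal_density.
Variable R : realType.
Notation mu := (@lebesgue_measure R).
Implicit Types (x : R).

Definition phi : R -> R := normal_pdf 0 1.

Lemma phiE x : phi x = phi 0 * expR (- (x ^+ 2 / 2)).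
Proof.
rewrite /phi normal_pdfE ?oner_eq0 // /normal_fun.
by rewrite !subr0 expr1n [0 ^+ _]expr0n /= oppr0 mul0r expR0 mulr1 mulNr.
Qed.

Lemma two_phi0 : 2 * phi 0 = Num.sqrt (2 / pi).
Proof.
rewrite /phi normal_pdfE ?oner_eq0 // /normal_fun /normal_peak.
rewrite subr0 [0 ^+ _]expr0n /= oppr0 mul0r expR0 mulr1 expr1n mul1r.
move: (pi : R) (pi_gt0 R) => p p0.
have -> : 2 / p = 2 ^+ 2 * (p *+ 2)^-1 by field; rewrite gt_eqF.
by rewrite sqrtrM ?exprn_ge0 // sqrtr_sqr ger0_norm // sqrtrV // mulrn_wge0 // ltW.
Qed.

Lemma phi_gt0 x : 0 < phi x.
Proof.
rewrite phiE mulr_gt0 ?expR_gt0//.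
have : 0 < 2 * phi 0 by rewrite two_phi0 sqrtr_gt0 divr_gt0 ?pi_gt0.
lra.
Qed.

Lemma phiN x : phi (- x) = phi x.
Proof. by rewrite phiE sqrrN -phiE. Qed.

Lemma phi_le0 x : phi x <= phi 0.
Proof.
rewrite phiE ler_piMr ?(ltW (phi_gt0 0)) // -expR0 ler_expR oppr_le0.
by rewrite divr_ge0 // sqr_ge0.
Qed.

Lemma is_derive_phi x : is_derive x 1 phi (- x * phi x).
Proof.
have -> : phi = fun t => phi 0 * expR (- (t * t / 2)).
  by apply/funext => t; rewrite phiE expr2.
have D1 : is_derive x 1 (fun t : R => - (t * t / 2)) (- x).
  apply: (is_derive_eq (is_derive_neg (is_derive_mul
    (is_derive_mul (is_derive_idf x) (is_derive_idf x)) (is_derive_const (2^-1) x)))) => /=.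
  by lra.
apply: (is_derive_eq (is_derive_mul (is_derive_const (phi 0) x)
  (is_derive_compf (is_derive_expR _) D1))) => /=.
by lra.
Qed.

Lemma continuous_phi : continuous phi.
Proof. by apply: continuous_normal_pdf; exact: oner_neq0. Qed.

Lemma integrable_phi : mu.-integrable setT (EFin \o phi).
Proof. exact: integrable_normal_pdf. Qed.

Lemma Rintegral_phi : \int[mu]_t phi t = 1.
Proof. by rewrite /Rintegral integral_normal_pdf. Qed.

(** From exp y >= 1 + y at y = x^2 / 2. *)
Lemma phi_decay x : 0 < x -> phi x <= phi 0 * (2 * x^-1 ^+ 2).
Proof.
move=> x0; rewrite phiE; apply: ler_pM => //; rewrite ?(ltW (phi_gt0 _)) ?expR_ge0//.
have -> : 2 * x^-1 ^+ 2 = (x ^+ 2 / 2)^-1 by field; rewrite gt_eqF.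
rewrite expRN lef_pV2 ?posrE ?expR_gt0 //; last by rewrite divr_gt0 ?exprn_gt0.
by apply: le_trans (expR_ge1Dx _); lra.
Qed.

Lemma cvg_id_phiy : x * phi x @[x --> +oo%R] --> (0:R).
Proof.
have L : phi 0 * 2 * x^-1 @[x --> +oo%R] --> (0:R).
  rewrite -[X in _ --> X](mulr0 (phi 0 * 2)).
  apply: cvgM; first exact: cvg_cst.
  apply/gtr0_cvgV0; last exact: cvg_id.
  by apply: nbhs_pinfty_gt; exact: num_real.
apply: squeeze_cvgr (cvg_cst 0) L.
near=> x. have x0 : 0 < x by near: x; apply: nbhs_pinfty_gt; exact: num_real.
apply/andP; split; first by rewrite mulr_ge0 ?(ltW (phi_gt0 _)) ?(ltW x0).
apply: le_trans (ler_wpM2l (ltW x0) (phi_decay x0)) _.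
by rewrite le_eqVlt; apply/orP; left; apply/eqP; field; rewrite gt_eqF.
Unshelve. all: by end_near. Qed.

Lemma cvg_phiy : phi x @[x --> +oo%R] --> (0:R).
Proof.
apply: squeeze_cvgr (cvg_cst 0) cvg_id_phiy.
near=> x. have x1 : 1 <= x by near: x; apply: nbhs_pinfty_ge; exact: num_real.
apply/andP; split; first exact: (ltW (phi_gt0 _)).
by rewrite ler_peMl // (ltW (phi_gt0 _)).
Unshelve. all: by end_near. Qed.

Lemma cvg_phiNy : phi x @[x --> -oo%R] --> (0:R).
Proof.
apply/cvgNy_compNP; rewrite (_ : _ \o _ = phi); first exact: cvg_phiy.
by apply/funext => x /=; rewrite phiN.
Qed.

Definition Phi x := \int[mu]_(t in `]-oo, x]) phi t.

Lemma is_derive_Phi x : is_derive x 1 Phi (phi x).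
Proof. by apply: is_derive_antiderivative; [exact: integrable_phi|exact: continuous_phi]. Qed.

Lemma cvg_Phiy : Phi x @[x --> +oo%R] --> (1:R).
Proof. by rewrite -Rintegral_phi; apply: cvg_antiderivativey; exact: integrable_phi. Qed.

Lemma cvg_PhiNy : Phi x @[x --> -oo%R] --> (0:R).
Proof. by apply: cvg_antiderivativeNy; exact: integrable_phi. Qed.

Definition Psi x := 1 - Phi x.

Lemma is_derive_Psi x : is_derive x 1 Psi (- phi x).
Proof. by apply: (is_derive_eq (is_derive_add (is_derive_const 1 x)
  (is_derive_neg (is_derive_Phi x)))); rewrite add0r. Qed.

Lemma cvg_Psiy : Psi x @[x --> +oo%R] --> (0:R).
Proof. by rewrite -(subrr 1); apply: cvgB; [exact: cvg_cst|exact: cvg_Phiy]. Qed.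

Lemma Psi_ge0 x : 0 <= Psi x.
Proof.
apply: (ge0_of_cvgy0 is_derive_Psi cvg_Psiy) => t _.
by rewrite oppr_le0 ltW ?phi_gt0.
Qed.

Lemma Phi_ge0 x : 0 <= Phi x.
Proof.
by apply: (ge0_of_cvgNy0 is_derive_Phi cvg_PhiNy) => t _; rewrite ltW ?phi_gt0.
Qed.

Lemma PhiN x : Phi (- x) = Psi x.
Proof.
have D (s : R) (t : R) : is_derive t 1 (fun t => s * (Psi t - Phi (- t))) 0.
  have D1 := is_derive_compf (is_derive_Phi (- t)) (is_derive_neg (is_derive_idf t)).
  apply: (is_derive_eq (is_derive_mul (is_derive_const s t)
    (is_derive_add (is_derive_Psi t) (is_derive_neg D1)))) => /=.
  by rewrite phiN; lra.
have L (s : R) : s * (Psi t - Phi (- t)) @[t --> +oo%R] --> (0:R).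
  rewrite -[X in _ --> X](mulr0 s); apply: cvgM; first exact: cvg_cst.
  rewrite -(subrr 0); apply: cvgB; first exact: cvg_Psiy.
  by have /cvgNy_compNP := cvg_PhiNy.
have H1 : 0 <= 1 * (Psi x - Phi (- x)) by exact: (ge0_of_cvgy0 (D 1) (L 1)).
have H2 : 0 <= -1 * (Psi x - Phi (- x)) by exact: (ge0_of_cvgy0 (D (-1)) (L (-1))).
lra.
Qed.

Lemma Mills_ub x : x * Psi x <= phi x.
Proof.
have D (t : R) : is_derive t 1 (fun t => phi t - x * Psi t) (- t * phi t + x * phi t).
  apply: (is_derive_eq (is_derive_add (is_derive_phi t)
    (is_derive_neg (is_derive_mul (is_derive_const x t) (is_derive_Psi t))))).
  by rewrite /=; lra.
rewrite -subr_ge0; apply: (ge0_of_cvgy0 D).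
  rewrite -[X in _ --> X](subrr 0); apply: cvgB; first exact: cvg_phiy.
  by rewrite -[X in _ --> X](mulr0 x); apply: cvgM; [exact: cvg_cst|exact: cvg_Psiy].
move=> t xt; rewrite -mulrDl; apply: mulr_le0_ge0; last exact: ltW (phi_gt0 _).
by rewrite addrC subr_le0.
Qed.

Lemma cvg_sqr_Psiy : x ^+ 2 * Psi x @[x --> +oo%R] --> (0:R).
Proof.
apply: squeeze_cvgr (cvg_cst 0) cvg_id_phiy.
near=> x. have x1 : 0 <= x by near: x; apply: nbhs_pinfty_ge; exact: num_real.
apply/andP; split; first by rewrite mulr_ge0 ?Psi_ge0 ?sqr_ge0.
by rewrite expr2 -mulrA ler_wpM2l // Mills_ub.
Unshelve. all: by end_near. Qed.

Lemma Mills_lb x : x * phi x <= (1 + x ^+ 2) * Psi x.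
Proof.
have D (t : R) : is_derive t 1 (fun t => (1 + t * t) * Psi t - t * phi t)
  (2 * (t * Psi t - phi t)).
  apply: (is_derive_eq (is_derive_add (is_derive_mul
    (is_derive_add (is_derive_const 1 t) (is_derive_mul (is_derive_idf t) (is_derive_idf t)))
    (is_derive_Psi t)) (is_derive_neg (is_derive_mul (is_derive_idf t) (is_derive_phi t))))).
  by rewrite /=; ring.
rewrite -subr_ge0 expr2; apply: (ge0_of_cvgy0 D).
  rewrite -[X in _ --> X](subrr 0); apply: cvgB; last exact: cvg_id_phiy.
  have -> : (fun t => (1 + t * t) * Psi t) = (fun t => Psi t + t ^+ 2 * Psi t).
    by apply/funext => t; ring.
  have := cvgD cvg_Psiy cvg_sqr_Psiy; rewrite addr0; exact.
by move=> t xt; apply: mulr_ge0_le0 => //; rewrite subr_le0 Mills_ub.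
Qed.

(** With r = Psi x / phi x this is r^2 + x r >= 1, Birnbaum's lower bound on the Mills
    ratio without its square root. The left-hand side tends to 0 and, by [Mills_lb], is
    nonincreasing. *)
Lemma Mills_quad x : 0 <= Psi x ^+ 2 + x * phi x * Psi x - phi x ^+ 2.
Proof.
have D (t : R) : is_derive t 1 (fun t => Psi t * Psi t + t * phi t * Psi t - phi t * phi t)
   (phi t * (t * phi t - (1 + t ^+ 2) * Psi t)).
  apply: (is_derive_eq (is_derive_add (is_derive_add
    (is_derive_mul (is_derive_Psi t) (is_derive_Psi t))
    (is_derive_mul (is_derive_mul (is_derive_idf t) (is_derive_phi t)) (is_derive_Psi t)))
   (is_derive_neg (is_derive_mul (is_derive_phi t) (is_derive_phi t))))).
  by rewrite /=; ring.
rewrite !expr2; apply: (ge0_of_cvgy0 D).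
  have [L1 L2 L3] := And3 cvg_Psiy cvg_id_phiy cvg_phiy.
  have := cvgB (cvgD (cvgM L1 L1) (cvgM L2 L1)) (cvgM L3 L3).
  by rewrite !mulr0 addr0 subr0; exact.
move=> t xt; apply: mulr_ge0_le0; first exact: ltW (phi_gt0 _).
by rewrite subr_le0 Mills_lb.
Qed.
End normal_density.

(** * Stein's equation for Lipschitz test functions *)

Section stein_bounds.
Variable R : realType.
Notation mu := (@lebesgue_measure R).
Notation phi := (@phi R).
Implicit Types (x : R).

Lemma lipschitz_of_derive (u du : R -> R) (K : R) : (forall t : R, is_derive t 1 u (du t)) ->
  (forall t, `|du t| <= K) -> forall x y, `|u x - u y| <= K * `|x - y|.
Proof.
move=> D B x y; wlog yx : x y / y <= x.
  move=> H; have [yx|/ltW yx] := leP y x; first exact: H.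
  by rewrite distrC (distrC x); apply: H.
have C : {within `[y, x], continuous u}.
  by apply: derivable_within_continuous => t _; have [] := D t.
have [c _ ->] := @MVT_segment R u du y x yx (fun t _ => D t) C.
by rewrite normrM ler_wpM2r.
Qed.

(** This is pi <= 4, as phi 0 ^ 2 = 1 / (2 pi). *)
Lemma sqr_phi0_ge : 1 <= 8 * phi 0 ^+ 2.
Proof.
have : (2 * phi 0) ^+ 2 = 2 / pi.
  by rewrite two_phi0 sqr_sqrtr // divr_ge0 ?pi_ge0.
have := pihalf_02 R; move: (pi : R) (phi 0 : R) => p q /andP[p0 p1] E.
have pp : 0 < p by lra.
have E2 : 4 / p = 2 * (2 / p) by ring.
have -> : 8 * q ^+ 2 = 4 / p by rewrite E2 -E; ring.
by rewrite ler_pdivlMr //; lra.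
Qed.

(** Squaring and using 8 (phi 0)^2 >= 1 leaves a polynomial in z^2 with a double root
    at 1/2; this double root is where the constant 5/4 comes from. *)
Lemma quartic_bound (z : R) : 0 <= z <= 1 -> z - z ^+ 3 <= phi 0 * (5 / 4 - z ^+ 4).
Proof.
move=> /andP[z0 z1].
have u1 : z ^+ 2 <= 1 by rewrite exprn_ile1.
have z4 : z ^+ 4 <= 1 by rewrite exprn_ile1.
have z3 : z ^+ 3 <= z by rewrite exprS ler_piMr.
have q0 : 0 < phi 0 := phi_gt0 0.
rewrite -(@ler_pXn2r _ 2) // ?nnegrE; last 2 first.
- lra.
- by apply: mulr_ge0; lra.
rewrite -(@ler_pM2l _ 8) //.
apply: (@le_trans _ _ ((5 / 4 - z ^+ 4) ^+ 2)).
  rewrite -subr_ge0.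
  have -> : (5 / 4 - z ^+ 4) ^+ 2 - 8 * (z - z ^+ 3) ^+ 2 =
    (z ^+ 2 - 1 / 2) ^+ 2 * ((1 - z ^+ 2) * (6 - z ^+ 2) + 1 / 4) by field.
  apply: mulr_ge0; first exact: sqr_ge0.
  by apply: addr_ge0; [apply: mulr_ge0; lra|lra].
rewrite exprMn mulrA -[leLHS]mul1r.
by apply: ler_wpM2r; [exact: sqr_ge0|exact: sqr_phi0_ge].
Qed.

Lemma Phi_Psi x : Phi x = 1 - Psi x. Proof. rewrite /Psi; ring. Qed.

(** The two factors are E (x - N)^+ and E (N - x)^+ for a standard normal N. They bound
    the integrals of [h - h x] over the half-lines on either side of x when [h] is
    1-Lipschitz, and their product governs the derivative of Stein's solution. *)
Lemma tail_means_le x : (x * Phi x + phi x) * (phi x - x * Psi x) <= 5 / 4 * phi 0 * phi x.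
Proof.
wlog x0 : x / 0 <= x.
  (* Replacing x by - x exchanges the two factors. *)
  move=> H; have [/H//|/ltW x0] := leP 0 x.
  have := H (- x); rewrite oppr_ge0 => /(_ x0); rewrite PhiN phiN.
  have := PhiN (- x); rewrite opprK => <-.
  by rewrite mulNr (addrC (- _)) mulNr opprK mulrC (addrC (phi x)).
have w0 := phi_gt0 x; have w1 := phi_le0 x.
have M1 := Mills_ub x; have M2 := Mills_quad x; have Q0 := Psi_ge0 x.
rewrite Phi_Psi.
set Q := Psi x in M1 M2 Q0 *; set w := phi x in w0 w1 M1 M2 *.
(* [r] is the Mills ratio and y = 1 - x r; [Mills_quad] says that y <= r^2. Hence
   z = sqrt y <= r, and x y = (x z) z <= (x r) z = (1 - z^2) z. *)
pose y := (w - x * Q) / w; pose r := Q / w.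
have yw : w - x * Q = y * w by rewrite /y divfK ?gt_eqF.
have rw : Q = r * w by rewrite /r divfK ?gt_eqF.
have y0 : 0 <= y by rewrite /y divr_ge0 ?subr_ge0 // ltW.
have r0 : 0 <= r by rewrite divr_ge0 // ltW.
have xr : x * r = 1 - y by rewrite /y /r; field; rewrite gt_eqF.
have yr : y <= r ^+ 2.
  rewrite -subr_ge0; have -> : r ^+ 2 - y = (Q ^+ 2 + x * w * Q - w ^+ 2) / w ^+ 2.
    by rewrite /y /r; field; rewrite gt_eqF.
  by rewrite divr_ge0 // sqr_ge0.
have y1 : y <= 1 by have : 0 <= x * r by [exact: mulr_ge0]; lra.
pose z := Num.sqrt y.
have z0 : 0 <= z := sqrtr_ge0 _.
have z2 : z ^+ 2 = y by rewrite sqr_sqrtr.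
have z1 : z <= 1 by rewrite -(@ler_pXn2r _ 2) ?nnegrE // expr1n z2.
have zr : z <= r by rewrite -(@ler_pXn2r _ 2) ?nnegrE // z2.
have xz : x * z <= 1 - z ^+ 2 by rewrite z2 -xr ler_wpM2l.
have xy : x * y <= z - z ^+ 3.
  have -> : x * y = x * z * z by rewrite -z2; ring.
  have -> : z - z ^+ 3 = (1 - z ^+ 2) * z by ring.
  by rewrite ler_wpM2r.
have -> : x * (1 - Q) + w = x + y * w by rewrite -yw; ring.
rewrite yw mulrA ler_pM2r //.
have q := quartic_bound (introT andP (conj z0 z1)).
have : y * w * y <= phi 0 * z ^+ 4.
  have -> : z ^+ 4 = y * y by rewrite -z2; ring.
  have -> : y * w * y = w * (y * y) by ring.
  by apply: ler_wpM2r => //; exact: mulr_ge0.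
by lra.
Qed.
End stein_bounds.

Section stein_equation.
Variable R : realType.
Notation mu := (@lebesgue_measure R).
Notation phi := (@phi R).
Implicit Types (x : R).

Lemma continuous_of_lipschitz (h : R -> R) : (forall x y, `|h x - h y| <= `|x - y|) ->
  continuous h.
Proof.
move=> H x; apply/cvgrPdist_lt => e e0; near=> y.
apply: le_lt_trans (H x y) _; near: y.
exact: cvgr_dist_lt.
Unshelve. all: by end_near. Qed.

(** A normal density of standard deviation 2 absorbs the linear factor, because
    |x| <= 1 + 3 x^2 / 8 <= exp (3 x^2 / 8). *)
Lemma absx_phi_le x : `|x| * phi x <= phi 0 / normal_peak 2 * normal_pdf 0 2 x.
Proof.
have p2 : 0 < normal_peak (2:R) by rewrite normal_peak_gt0.
rewrite normal_pdfE // /normal_fun subr0 phiE [leRHS]mulrA divfK ?gt_eqF //.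
rewrite mulrCA ler_wpM2l ?(ltW (phi_gt0 _)) //.
have -> : - x ^+ 2 / (2 ^+ 2 *+ 2) = 3 / 8 * x ^+ 2 - x ^+ 2 / 2 by field.
rewrite expRD ler_wpM2r ?expR_ge0 //; apply: le_trans (expR_ge1Dx _).
have := sqr_ge0 (`|x| - 4 / 3); rewrite -(real_normK (num_real x)).
move: `|x| => a; lra.
Qed.

Lemma integrable_lipschitz_phi (h : R -> R) : (forall x y, `|h x - h y| <= `|x - y|) ->
  mu.-integrable setT (EFin \o (fun x => h x * phi x)).
Proof.
move=> H.
have ch := continuous_of_lipschitz H.
pose g x : R := `|h 0| * phi x + phi 0 / normal_peak 2 * normal_pdf 0 2 x.
have ig : mu.-integrable setT (EFin \o g).
  rewrite /g /comp; under eq_fun do rewrite EFinD !EFinM.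
  apply: integrableD => //; apply: integrableZl => //.
    exact: integrable_phi.
  exact: integrable_normal_pdf.
apply: (le_integrable measurableT _ _ ig).
  apply/measurable_EFinP; apply: measurable_funM.
    exact: continuous_measurable_fun.
  exact: measurable_normal_pdf.
move=> x _; rewrite /g /= lee_fin.
have p2 : 0 < normal_peak (2:R) by rewrite normal_peak_gt0.
have a0 := phi_gt0 x.
rewrite normrM (ger0_norm (ltW a0)) [leRHS]ger0_norm; last first.
  apply: addr_ge0; apply: mulr_ge0 => //; rewrite ?(ltW a0) ?normal_pdf_ge0 //.
  by rewrite divr_ge0 ?(ltW p2) // ltW ?phi_gt0.
apply: le_trans (lerD (lexx _) (absx_phi_le x)).
rewrite -mulrDl ler_wpM2r ?(ltW a0) //.
rewrite -lerBlDl; apply: le_trans (lerB_dist _ _) _.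
by have := H x 0; rewrite subr0.
Qed.

Lemma is_derive_inv (u : R -> R) (du x : R) : u x != 0 -> is_derive x 1 u du ->
  is_derive x 1 (fun t => (u t)^-1) (- u x ^- 2 * du).
Proof. by move=> H D; exact: (is_deriveV H D). Qed.

Lemma cvg_to_eq (F : set_system R) (u : R -> R) (l l' : R) :
  u x @[x --> F] --> l -> l = l' -> u x @[x --> F] --> l'.
Proof. by move=> H <-. Qed.

(** The solution is [G / phi], where m is the normal mean of [h] and [G] is the
    antiderivative of [(h - m) * phi] that vanishes at both infinities. Fix x. On each half-line
    [h t - h x] is at most [|t - x|] in
    absolute value, so comparing derivatives bounds a = G x - (h x - m) Phi x and
    b = G x + (h x - m) Psi x by the two means of [tail_means_le]; and f x, f' x,
    f x + x f' x are linear in a and b. The bound on f' is then [tail_means_le]. The bound on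
    f x + x f' x, the derivative of x f x, is exactly 1; so x f x is 1-Lipschitz and
    f' x = x f x + h x - m is 2-Lipschitz, although h may fail to be differentiable. *)
Lemma stein_solution (h : R -> R) : (forall x y, `|h x - h y| <= `|x - y|) ->
  exists f f' : R -> R,
  [/\ forall x : R, is_derive x 1 f (f' x),
      forall x, f' x - x * f x = h x - \int[mu]_t (h t * phi t),
      forall x, `|f' x| <= 5 / 4 * Num.sqrt (2 / pi) &
      forall x y, `|f' x - f' y| <= 2 * `|x - y| ].
Proof.
move=> H; have ch := continuous_of_lipschitz H; have ih := integrable_lipschitz_phi H.
set m := \int[mu]_t (h t * phi t).
have chphi : continuous (fun t => h t * phi t).
  by move=> x; apply: cvgM; [exact: ch|exact: continuous_phi].
pose I x := \int[mu]_(t in `]-oo, x]) (h t * phi t).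
pose G x := I x - m * Phi x.
have DG (x : R) : is_derive x 1 G ((h x - m) * phi x).
  apply: (is_derive_eq (is_derive_add (is_derive_antiderivative x ih chphi)
    (is_derive_neg (is_derive_mul (is_derive_const m x) (is_derive_Phi x))))) => /=.
  by ring.
have GNy : G x @[x --> -oo%R] --> (0:R).
  apply: (cvg_to_eq (cvgB (cvg_antiderivativeNy ih) (cvgM (cvg_cst m) (@cvg_PhiNy R)))).
  by ring.
have Gy : G x @[x --> +oo%R] --> (0:R).
  apply: (cvg_to_eq (cvgB (cvg_antiderivativey ih) (cvgM (cvg_cst m) (@cvg_Phiy R)))).
  by rewrite mulr1 subrr.
(* The sign [s] stands for the upper and the lower bound. *)
have left_bound (s x : R) : `|s| = 1 -> 0 <= x * Phi x + phi x + s * (G x - (h x - m) * Phi x).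
  move=> s1.
  have D (t : R) : is_derive t 1 (fun t => x * Phi t + phi t + s * (G t - (h x - m) * Phi t))
     (phi t * ((x - t) + s * (h t - h x))).
    apply: (is_derive_eq (is_derive_add (is_derive_add
      (is_derive_mul (is_derive_const x t) (is_derive_Phi t)) (is_derive_phi t))
      (is_derive_mul (is_derive_const s t) (is_derive_add (DG t)
        (is_derive_neg (is_derive_mul (is_derive_const (h x - m) t) (is_derive_Phi t))))))) => /=.
    by ring.
  apply: (ge0_of_cvgNy0 D).
    apply: (cvg_to_eq (cvgD (cvgD (cvgM (cvg_cst x) (@cvg_PhiNy R)) (@cvg_phiNy R))
      (cvgM (cvg_cst s) (cvgB GNy (cvgM (cvg_cst (h x - m)) (@cvg_PhiNy R)))))).
    by ring.
  move=> t tx; apply: mulr_ge0; first exact: ltW (phi_gt0 _).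
  have : - (s * (h t - h x)) <= x - t.
    rewrite -mulrN; apply: le_trans (ler_norm _) _; rewrite normrM s1 mul1r normrN.
    by apply: le_trans (H _ _) _; rewrite distrC ger0_norm // subr_ge0.
  by lra.
have right_bound (s x : R) : `|s| = 1 -> 0 <= phi x - x * Psi x + s * (G x + (h x - m) * Psi x).
  move=> s1.
  have D (t : R) : is_derive t 1 (fun t => phi t - x * Psi t + s * (G t + (h x - m) * Psi t))
     (- (phi t * ((t - x) + s * (h x - h t)))).
    apply: (is_derive_eq (is_derive_add (is_derive_add (is_derive_phi t)
      (is_derive_neg (is_derive_mul (is_derive_const x t) (is_derive_Psi t))))
      (is_derive_mul (is_derive_const s t) (is_derive_add (DG t)
        (is_derive_mul (is_derive_const (h x - m) t) (is_derive_Psi t)))))) => /=.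
    by ring.
  apply: (ge0_of_cvgy0 D).
    apply: (cvg_to_eq (cvgD (cvgB (@cvg_phiy R) (cvgM (cvg_cst x) (@cvg_Psiy R)))
      (cvgM (cvg_cst s) (cvgD Gy (cvgM (cvg_cst (h x - m)) (@cvg_Psiy R)))))).
    by ring.
  move=> t tx; rewrite oppr_le0; apply: mulr_ge0; first exact: ltW (phi_gt0 _).
  have : - (s * (h x - h t)) <= t - x.
    rewrite -mulrN; apply: le_trans (ler_norm _) _; rewrite normrM s1 mul1r normrN.
    by apply: le_trans (H _ _) _; rewrite distrC ger0_norm // subr_ge0.
  by lra.
pose f x := G x * (phi x)^-1.
pose f' x := x * f x + (h x - m).
have phin0 x : phi x != 0 by rewrite gt_eqF // phi_gt0.
have Df (x : R) : is_derive x 1 f (f' x).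
  apply: (is_derive_eq (is_derive_mul (DG x) (is_derive_inv (phin0 x) (is_derive_phi x)))).
  by rewrite /f' /f; field; exact: phin0.
(* Since Phi + Psi = 1, both [G x] and [h x - m] are recovered from [a] and [b]. *)
have key x : exists a b, let A := x * Phi x + phi x in let B := phi x - x * Psi x in
  [/\ `|a| <= A, `|b| <= B, G x = a * Psi x + b * Phi x & h x - m = b - a].
  exists (G x - (h x - m) * Phi x), (G x + (h x - m) * Psi x); split.
  - have := left_bound 1 x (normr1 _); have := left_bound (-1) x (normrN1 _).
    by rewrite ler_norml; lra.
  - have := right_bound 1 x (normr1 _); have := right_bound (-1) x (normrN1 _).
    by rewrite ler_norml; lra.
  - by rewrite Phi_Psi; ring.
  - by rewrite Phi_Psi; ring.
exists f, f'; split.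
- exact: Df.
- by move=> x; rewrite /f'; ring.
- move=> x; have [a [b [ha hb E1 E2]]] := key x.
  set A := x * Phi x + phi x in ha *; set B := phi x - x * Psi x in hb *.
  have A0 : 0 <= A := le_trans (normr_ge0 _) ha.
  have B0 : 0 <= B := le_trans (normr_ge0 _) hb.
  have -> : f' x = (b * A - a * B) / phi x.
    by rewrite /f' /f E1 E2 /A /B; field; exact: phin0.
  rewrite normrM normfV (ger0_norm (ltW (phi_gt0 x))) ler_pdivrMr ?phi_gt0 //.
  apply: le_trans (ler_normB _ _) _; rewrite !normrM (ger0_norm A0) (ger0_norm B0).
  have h1 := ler_wpM2r A0 hb; have h2 := ler_wpM2r B0 ha.
  have := tail_means_le x; rewrite -/A -/B -two_phi0 => h3.
  by lra.
- have Dxf (x : R) : is_derive x 1 (fun t => t * f t) (x * f' x + f x).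
    by apply: (is_derive_eq (is_derive_mul (is_derive_idf x) (Df x))); rewrite mulr1.
  have L : forall x y, `|x * f x - y * f y| <= 1 * `|x - y|.
    apply: (lipschitz_of_derive Dxf) => x; have [a [b [ha hb E1 E2]]] := key x.
    have P0 := Phi_ge0 x; have Q0 := Psi_ge0 x; have w0 := phi_gt0 x.
    have Q1 : 0 <= (1 + x ^+ 2) * Psi x - x * phi x by rewrite subr_ge0 Mills_lb.
    have P1 : 0 <= (1 + x ^+ 2) * Phi x + x * phi x.
      by have := Mills_lb (- x); rewrite phiN -PhiN opprK sqrrN; lra.
    have -> : x * f' x + f x = (a * ((1 + x ^+ 2) * Psi x - x * phi x) +
      b * ((1 + x ^+ 2) * Phi x + x * phi x)) / phi x.
      by rewrite /f' /f E1 E2; field; exact: phin0.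
    rewrite normrM normfV (ger0_norm (ltW w0)) ler_pdivrMr // mul1r.
    apply: le_trans (ler_normD _ _) _; rewrite !normrM (ger0_norm P1) (ger0_norm Q1).
    apply: le_trans (lerD (ler_wpM2r Q1 ha) (ler_wpM2r P1 hb)) _.
    by rewrite le_eqVlt; apply/orP; left; apply/eqP; rewrite Phi_Psi; ring.
  move=> x y; have -> : f' x - f' y = (x * f x - y * f y) + (h x - h y) by rewrite /f'; ring.
  apply: le_trans (ler_normD _ _) _.
  by have := L x y; have := H x y; lra.
Qed.
End stein_equation.

(** * Expectation under the standard normal law *)

Section normal_expectation.
Variable R : realType.
Notation mu := (@lebesgue_measure R).
Notation phi := (@phi R).
Notation nu := (@normal_prob R 0 1).
Implicit Types (x : R).

Lemma measurable_phi : measurable_fun setT (EFin \o phi).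
Proof. by apply/measurable_EFinP; exact: measurable_normal_pdf. Qed.

(** By uniqueness of the Radon-Nikodym derivative. *)
Lemma integral_normal_prob (f : R -> \bar R) : nu.-integrable setT f ->
  (\int[nu]_x f x = \int[mu]_x (f x * (phi x)%:E))%E.
Proof.
move=> fi; have numu := @normal_prob_dominates R 0 1.
rewrite -(Radon_Nikodym_change_of_variables numu) //=.
apply: ae_eq_integral => //.
- apply: emeasurable_funM; first exact: measurable_int fi.
  apply: (measurable_int mu).
  exact: Radon_Nikodym_integrable.
- apply: emeasurable_funM; first exact: measurable_int fi.
  exact: measurable_phi.
- apply: ae_eqe_mul2l => /=.
  rewrite Radon_NikodymE.
  case: cid => /= k [k1 k2 k3].
  apply: integral_ae_eq => //=.
  + exact: measurable_phi.
  + by move=> A _ mA; rewrite -k3.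
Qed.

(** [integral_normal_prob] presupposes integrability, so it is applied to the truncations
    of [|h|] at level n, whose integrals are at most that of [|h * phi|]; monotone convergence
    concludes. *)
Lemma integrable_lipschitz_normal (h : R -> R) : (forall x y, `|h x - h y| <= `|x - y|) ->
  nu.-integrable setT (EFin \o h).
Proof.
move=> H; have ch := continuous_of_lipschitz H.
have mh : measurable_fun setT h by exact: continuous_measurable_fun.
apply/integrableP; split; first exact/measurable_EFinP.
pose g (n : nat) x := (Num.min `|h x| n%:R)%:E.
have mg n : measurable_fun setT (g n).
  apply/measurable_EFinP; apply: measurable_minr => //.
  exact: measurableT_comp.
have g0 n x : (0 <= g n x)%E by rewrite lee_fin le_min normr_ge0 ler0n.
have nd x : {homo g^~ x : n m / (n <= m)%N >-> (n <= m)%E}.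
  move=> n m nm; rewrite lee_fin le_min ge_min lexx /=.
  by rewrite ge_min ler_nat nm orbT.
have := @cvg_monotone_convergence _ _ _ nu setT measurableT g mg (fun n x _ => g0 n x)
  (fun x _ => nd x).
have -> : (fun x => limn (g^~ x)) = (fun x => `|(EFin \o h) x|%E).
  apply/funext => x; apply/cvg_lim => //; apply: cvg_near_cst.
  exists (Num.truncn `|h x|).+1 => //= n /= nx; rewrite /g; congr (_%:E).
  apply/min_idPl. apply: le_trans (ltW (truncnS_gt _)) _ => //.
  by rewrite ler_nat.
move=> L.
have ih := integrable_abse (integrable_lipschitz_phi H).
apply: (@le_lt_trans _ _ (\int[mu]_x (`|h x * phi x|)%:E)%E); last first.
  by have /integrableP[_] := integrable_lipschitz_phi H.
have -> : (\int[nu]_x `|(EFin \o h) x|)%E = limn (fun n => \int[nu]_x g n x)%E.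
  by apply/esym/cvg_lim.
apply: lime_le; first by apply/cvg_ex; eexists; exact: L.
apply: nearW => n.
have ig : nu.-integrable setT (g n).
  apply/integrableP; split; first exact: mg.
  apply: (@le_lt_trans _ _ (\int[nu]_(x in setT) (n%:R : R)%:E)%E).
    apply: ge0_le_integral => //.
    - by apply: measurableT_comp => //; exact: mg.
    - by move=> x _; rewrite gee0_abs // lee_fin ge_min lexx orbT.
  by rewrite integral_cst //= probability_setT mule1 ltry.
rewrite integral_normal_prob //; apply: ge0_le_integral => //.
- by move=> x _; rewrite mule_ge0 // lee_fin ltW // phi_gt0.
- by apply: emeasurable_funM; [exact: mg|exact: measurable_phi].
- by have /integrableP[] := ih.
- move=> x _; rewrite -EFinM lee_fin normrM (ger0_norm (ltW (phi_gt0 _))).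
  by rewrite ler_wpM2r ?(ltW (phi_gt0 _)) // ge_min lexx.
Qed.

(** Random variables take values in the Borel sets of [R], Lebesgue measure lives on the
    sigma-algebra generated by half-open intervals: the same sets in two structures,
    between which the identity function passes. *)
Let idTR : measurableTypeR R -> R := idfun.
#[local] HB.instance Definition _ :=
  @isMeasurableFun.Build _ _ (measurableTypeR R) R idTR (fun mD Y mY => measurableI _ _ mD mY).

Lemma expectation_std_normal d (T : measurableType d) (Q : probability T R)
   (Z : {RV Q >-> R}) (h : R -> R) :
  standard_normal Z -> (forall x y, `|h x - h y| <= `|x - y|) ->
  'E_Q[h \o Z]%E = (\int[mu]_t (h t * phi t))%:E.
Proof.
move=> hZ H; have ih := integrable_lipschitz_normal H.
have ch := continuous_of_lipschitz H.
have mh : measurable_fun [set: R] (EFin \o h) by apply/measurable_EFinP;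
  exact: continuous_measurable_fun.
have mah : measurable_fun [set: R] (abse \o (EFin \o h)) by apply: measurableT_comp.
have dE (f : R -> \bar R) : (\int[distribution Q Z]_x f x = \int[distribution nu idTR]_x f x)%E.
  by apply: eq_measure_integral => A mA _; exact: hZ.
have ihZ : Q.-integrable setT ((EFin \o h) \o Z).
  apply/integrableP; split; first exact: measurableT_comp.
  have -> : (\int[Q]_x `|((EFin \o h) \o Z) x| = \int[nu]_x `|(EFin \o h) x|)%E.
    rewrite -(@ge0_integral_distribution _ _ _ _ _ Q Z (abse \o (EFin \o h)) mah
      (fun => abse_ge0 _)).
    by rewrite dE (@ge0_integral_distribution _ _ _ _ _ nu idTR (abse \o (EFin \o h)) mah
      (fun => abse_ge0 _)).
  by have /integrableP[] := ih.
rewrite unlock -(integral_distribution mh ihZ) dE integral_distribution //.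
rewrite [LHS]integral_normal_prob // /Rintegral fineK //.
apply: integrable_fin_num => //; exact: integrable_lipschitz_phi.
Qed.
End normal_expectation.

(** * Uniform random colorings *)

Section coloring.
Variables (R : realType) (n c : nat).
Hypothesis c0 : (0 < c)%N.
Notation Om := {ffun 'I_n -> 'I_c}.
Implicit Types (x y : Om) (g k : Om -> R) (i j : 'I_n).

Definition mean g : R := c%:R ^- n * \sum_x g x.

Definition recolor x (j : 'I_n) (u : 'I_c) : Om := [ffun i => if i == j then u else x i].

(** The conditional expectation given the colors of all vertices other than [j]. *)
Definition resample j g x : R := c%:R^-1 * \sum_u g (recolor x j u).
Local Notation p := (c%:R^-1 : R).
Let pn0 : (c%:R : R) != 0. Proof. by rewrite pnatr_eq0 -lt0n. Qed.

Lemma recolorE x j u : recolor x j u j = u. Proof. by rewrite ffunE eqxx. Qed.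

Lemma recolorNE x j u i : i != j -> recolor x j u i = x i.
Proof. by move=> ij; rewrite ffunE (negbTE ij). Qed.

Lemma recolorK x j u w : recolor (recolor x j u) j w = recolor x j w.
Proof. by apply/ffunP => i; rewrite !ffunE; case: eqP. Qed.

Lemma recolor_id x j : recolor x j (x j) = x.
Proof. by apply/ffunP => i; rewrite !ffunE; case: eqP => // ->. Qed.

Lemma eq_mean g k : g =1 k -> mean g = mean k.
Proof. by move=> e; rewrite /mean (eq_bigr k). Qed.

Lemma meanD g k : mean (fun x => g x + k x) = mean g + mean k.
Proof. by rewrite /mean big_split /= mulrDr. Qed.

Lemma meanZ a g : mean (fun x => a * g x) = a * mean g.
Proof. by rewrite /mean -mulr_sumr mulrCA. Qed.

Lemma meanN g : mean (fun x => - g x) = - mean g.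
Proof. by rewrite /mean sumrN mulrN. Qed.

Lemma mean_sum (I : Type) (r : seq I) (Q : pred I) (G : I -> Om -> R) :
  mean (fun x => \sum_(i <- r | Q i) G i x) = \sum_(i <- r | Q i) mean (G i).
Proof. by rewrite /mean exchange_big /= mulr_sumr. Qed.

Lemma mean_cst a : mean (fun=> a) = a.
Proof.
rewrite /mean sumr_const card_ffun !card_ord -[_ *+ (_ ^ _)]mulr_natl natrX.
by rewrite mulrA mulVf ?mul1r // expf_eq0 negb_and pn0 orbT.
Qed.

Lemma le_mean g k : (forall x, g x <= k x) -> mean g <= mean k.
Proof.
move=> H; rewrite /mean ler_wpM2l ?invr_ge0 ?exprn_ge0 //.
by apply: ler_sum => x _.
Qed.

Lemma mean_ge0 g : (forall x, 0 <= g x) -> 0 <= mean g.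
Proof. by move=> H; rewrite -[0](mean_cst 0); exact: le_mean. Qed.

(** Exchangeability: (x, u) |-> (recolor x j u, x j) is an involution. *)
Lemma resample_swap j (K : Om -> Om -> R) :
  mean (fun x => c%:R^-1 * \sum_u K x (recolor x j u)) =
  mean (fun x => c%:R^-1 * \sum_u K (recolor x j u) x).
Proof.
rewrite !meanZ /mean; congr (_ * (_ * _)).
rewrite !pair_big /=.
pose s (z : Om * 'I_c) : Om * 'I_c := (recolor z.1 j z.2, z.1 j).
have sK : involutive s.
  by move=> [x u]; rewrite /s /= recolorK recolor_id recolorE.
rewrite [RHS](reindex_inj (inv_inj sK)) /=.
by apply: eq_bigr => -[x u] _ /=; rewrite recolorK recolor_id.
Qed.

Lemma mean_resample j g : mean (resample j g) = mean g.
Proof.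
rewrite /resample (resample_swap j (fun _ y => g y)).
by apply: eq_mean => x; rewrite sumr_const card_ord -[g x *+ c]mulr_natl mulKf.
Qed.

Definition indep_of j g := forall x u, g (recolor x j u) = g x.

Lemma resampleMl j g k x : indep_of j g -> resample j (fun x => g x * k x) x =
  g x * resample j k x.
Proof.
move=> H; rewrite /resample mulrCA; congr (_ * _); rewrite mulr_sumr.
by apply: eq_bigr => u _; rewrite H.
Qed.

Lemma resample_indep j g x : indep_of j g -> resample j g x = g x.
Proof.
move=> H; rewrite /resample (eq_bigr (fun=> g x)); last by move=> u _; exact: H.
by rewrite sumr_const card_ord -[g x *+ c]mulr_natl mulKf.
Qed.

Lemma resampleD j g k x : resample j (fun x => g x + k x) x = resample j g x + resample j k x.
Proof. by rewrite /resample big_split mulrDr. Qed.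

Lemma resampleZ j a g x : resample j (fun x => a * g x) x = a * resample j g x.
Proof. by rewrite /resample -mulr_sumr mulrCA. Qed.

Lemma eq_resample j g k x : g =1 k -> resample j g x = resample j k x.
Proof. by move=> e; rewrite /resample (eq_bigr (fun u => k (recolor x j u))). Qed.

Lemma resample_sum j (I : Type) (r : seq I) (Q : pred I) (G : I -> Om -> R) x :
  resample j (fun x => \sum_(i <- r | Q i) G i x) x = \sum_(i <- r | Q i) resample j (G i) x.
Proof. by rewrite /resample exchange_big /= mulr_sumr. Qed.

(** The source of every orthogonality relation below. *)
Lemma mean_kill j g k : indep_of j g -> (forall x, resample j k x = 0) ->
  mean (fun x => g x * k x) = 0.
Proof.
move=> H K; rewrite -(mean_resample j) -[RHS](mean_cst 0); apply: eq_mean => x.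
by rewrite resampleMl // K mulr0.
Qed.

Definition cmatch i j x : R := (x i == x j)%:R - c%:R^-1.
Local Notation W := cmatch.

Definition vmatch : R := c%:R^-1 * (1 - c%:R^-1).

Lemma cmatchC i j x : W i j x = W j i x. Proof. by rewrite /W eq_sym. Qed.

Lemma cmatchxx i x : W i i x = 1 - p. Proof. by rewrite /W eqxx. Qed.

Lemma sum_eq (F : 'I_c -> R) a : \sum_u (a == u)%:R * F u = F a.
Proof.
rewrite (bigD1 a) //= eqxx mul1r big1 ?addr0 // => u ua.
by rewrite eq_sym (negbTE ua) mul0r.
Qed.

Lemma resample_eq j i x : i != j -> resample j (fun x => (x i == x j)%:R) x = p.
Proof.
move=> ij; rewrite /resample (eq_bigr (fun u => (x i == u)%:R * 1)).
  by rewrite sum_eq mulr1.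
by move=> u _; rewrite recolorE recolorNE // mulr1.
Qed.

Lemma indep_cmatch j i (k : 'I_n) : i != j -> k != j -> indep_of j (W i k).
Proof. by move=> ij kj x u; rewrite /W !recolorNE. Qed.

Lemma indep_cst j a : indep_of j (fun=> a). Proof. by []. Qed.

Lemma resample_cmatchr j i x : i != j -> resample j (W i j) x = 0.
Proof.
move=> ij; rewrite /W resampleD resample_eq //.
by rewrite (resample_indep _ (indep_cst _ _)) subrr.
Qed.

Lemma resample_cmatchl j i x : i != j -> resample j (W j i) x = 0.
Proof. by move=> ij; rewrite (@eq_resample _ _ (W i j)) ?resample_cmatchr // => y;
  rewrite cmatchC. Qed.

(** The case i = k is included: [W i i] is the constant 1 - 1/c. *)
Lemma resample_cherry j i (k : 'I_n) x : i != j -> k != j ->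
  resample j (fun x => W i j x * W j k x) x = p * W i k x.
Proof.
move=> ij kj.
have -> : resample j (fun x => W i j x * W j k x) x =
  resample j (fun x => (x i == x j)%:R * (x k == x j)%:R +
    (- p * W i j x + (- p * W j k x - p ^+ 2))) x.
  by apply: eq_resample => y; rewrite /W (eq_sym (y j)); ring.
rewrite !resampleD !resampleZ resample_cmatchr // resample_cmatchl //
  (resample_indep _ (indep_cst _ _)).
rewrite /resample (eq_bigr (fun u => (x i == u)%:R * (x k == u)%:R)); last first.
  by move=> u _; rewrite recolorE !recolorNE.
by rewrite (sum_eq (fun u => (x k == u)%:R)) /W (eq_sym (x k)); ring.
Qed.

Lemma cmatch_sqr i j x : W i j x ^+ 2 = (1 - 2 * p) * W i j x + vmatch.
Proof. by rewrite /W /vmatch; case: eqP => _ /=; ring. Qed.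

Lemma mean_cmatch i (k : 'I_n) : i != k -> mean (W i k) = 0.
Proof.
move=> ik; rewrite -(mean_resample k) -[RHS](mean_cst 0); apply: eq_mean => x.
exact: resample_cmatchr.
Qed.

Lemma mean_cmatch_sqr i (k : 'I_n) : i != k -> mean (fun x => W i k x * W i k x) = vmatch.
Proof.
move=> ik; rewrite (@eq_mean _ (fun x => (1 - 2 * p) * W i k x + vmatch)).
  by rewrite meanD meanZ mean_cmatch // mulr0 add0r mean_cst.
by move=> x; rewrite -expr2 cmatch_sqr.
Qed.

(** Pairs that differ are uncorrelated even when they share a vertex: recolor a vertex
    that belongs to only one of them. *)
Lemma mean_cmatchM (i k i' k' : 'I_n) : i != k -> i' != k' ->
  mean (fun x => W i k x * W i' k' x) = vmatch *
    ((i' == i)%:R * (k' == k)%:R + (i' == k)%:R * (k' == i)%:R).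
Proof.
move=> ik ik'.
have [ii'|ii'] := eqVneq i' i; have [kk'|kk'] := eqVneq k' k.
- by subst; rewrite mean_cmatch_sqr // (negbTE ik) (eq_sym k) (negbTE ik) /=; ring.
- subst; rewrite (negbTE ik) /=; transitivity (0 : R); last by ring.
  apply: (@mean_kill k'); first by apply: indep_cmatch => //; rewrite eq_sym.
  by move=> x; apply: resample_cmatchr.
- subst; rewrite (eq_sym k) (negbTE ik) /=; transitivity (0 : R); last by ring.
  apply: (@mean_kill i'); first by apply: indep_cmatch; rewrite // eq_sym.
  by move=> x; rewrite resample_cmatchl // eq_sym.
- rewrite /= mul0r add0r.
  have [ik1|ik1] := eqVneq i' k; last first.
    rewrite mul0r mulr0; apply: (@mean_kill i'); first by apply: indep_cmatch; rewrite // eq_sym.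
    by move=> x; rewrite resample_cmatchl // eq_sym.
  have [ki1|ki1] := eqVneq k' i; last first.
    rewrite !mulr0; apply: (@mean_kill k'); first by apply: indep_cmatch; rewrite // eq_sym.
    by move=> x; rewrite resample_cmatchr.
  subst; rewrite (@eq_mean _ (fun x => W i k x * W i k x)).
    by rewrite mean_cmatch_sqr //= !mulr1.
  by move=> x; rewrite (cmatchC k).
Qed.

Lemma sum_delta (I : finType) (F : I -> R) a : \sum_i (i == a)%:R * F i = F a.
Proof.
rewrite (bigD1 a) //= eqxx mul1r big1 ?addr0 // => u ua.
by rewrite (negbTE ua) mul0r.
Qed.

Lemma mean_form2_sqr (g : 'I_n -> 'I_n -> R) : (forall i, g i i = 0) ->
  mean (fun x => (\sum_i \sum_k g i k * W i k x) ^+ 2) =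
  vmatch * \sum_i \sum_k g i k * (g i k + g k i).
Proof.
move=> g0.
have -> : mean (fun x => (\sum_i \sum_k g i k * W i k x) ^+ 2) =
  \sum_i \sum_k \sum_i' \sum_k' g i k * g i' k' * mean (fun x => W i k x * W i' k' x).
  rewrite (@eq_mean _ (fun x => \sum_i \sum_k \sum_i' \sum_k' (g i k * g i' k') *
    (W i k x * W i' k' x))).
    rewrite mean_sum; apply: eq_bigr => i _; rewrite mean_sum; apply: eq_bigr => k _.
    rewrite mean_sum; apply: eq_bigr => i' _; rewrite mean_sum; apply: eq_bigr => k' _.
    by rewrite meanZ.
  move=> x; rewrite expr2 mulr_suml; apply: eq_bigr => i _.
  rewrite mulr_suml; apply: eq_bigr => k _; rewrite mulr_sumr; apply: eq_bigr => i' _.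
  by rewrite mulr_sumr; apply: eq_bigr => k' _; ring.
rewrite mulr_sumr; apply: eq_bigr => i _; rewrite mulr_sumr; apply: eq_bigr => k _.
have [->|ik] := eqVneq i k.
  rewrite g0 !mul0r mulr0; apply: big1 => i' _; apply: big1 => k' _; by rewrite !mul0r.
transitivity (vmatch * g i k * (\sum_i' (i' == i)%:R * (\sum_k' (k' == k)%:R * g i' k') +
  \sum_i' (i' == k)%:R * (\sum_k' (k' == i)%:R * g i' k'))).
  rewrite -big_split mulr_sumr; apply: eq_bigr => i' _.
  rewrite /= !mulr_sumr -big_split mulr_sumr; apply: eq_bigr => k' _ /=.
  have [->|ik'] := eqVneq i' k'; first by rewrite g0; ring.
  by rewrite mean_cmatchM //; ring.
by rewrite !sum_delta; ring.
Qed.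
End coloring.

(** * From independent uniform colors to uniform colorings *)

Section colors.
Context (R : realType) (n c : nat) d (T : measurableType d) (P : probability T R).
Variable X : 'I_n -> {RV P >-> nat}.
Hypothesis X_indep : mutually_independent X.
Hypothesis X_unif : forall i, uniform_on_1_to c (X i).
Hypothesis c0 : (0 < c)%N.

(** The vector of colors takes countably many values. *)
Lemma measurable_fun_countable (g : ('I_n -> nat) -> R) :
  measurable_fun setT (fun w => g (fun i => X i w)).
Proof.
move=> _ B mB; rewrite setTI.
pose colored (y : {ffun 'I_n -> nat}) := if pselect (B (g y)) then \big[setI/setT]_(i < n)
  (X i @^-1` [set y i]) else set0.
rewrite (_ : _ @^-1` B = \bigcup_y colored y); last first.
  apply/seteqP; split => [w /= Bw|w [y _]].
    exists [ffun i => X i w] => //; rewrite /colored.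
    have E : (fun i => X i w) = [ffun i => X i w] by apply/funext => i; rewrite ffunE.
    case: (pselect (B (g [ffun i => X i w]))) => [By|]; last by rewrite -E.
    by rewrite -bigcap_seq => i ii /=; rewrite ffunE.
  rewrite /colored; case: (pselect (B (g y))) => [By|] //; rewrite -bigcap_seq => H /=.
  suff -> : (fun i => X i w) = y by [].
  by apply/funext => i; apply: H; rewrite /= mem_index_enum.
apply: countable_bigcupT_measurable => [|y]; first exact: countableP.
rewrite /colored; case: (pselect (B (g y))) => By; last exact: measurable0.
apply: bigsetI_measurable => i _; rewrite -[X in measurable X]setTI.
exact: measurable_funP.
Qed.

Let Om := {ffun 'I_n -> 'I_c}.
Let colored (x : Om) := [set w | forall i, X i w = (x i).+1].

Lemma colored_setI x : colored x = \big[setI/setT]_(i < n) (X i @^-1` [set (x i : nat).+1]).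
Proof.
apply/seteqP; split => w /=; rewrite -bigcap_seq.
  by move=> H i ii; exact: H.
by move=> H i; apply: H; rewrite /= mem_index_enum.
Qed.

Lemma measurable_colored x : measurable (colored x).
Proof.
rewrite colored_setI; apply: bigsetI_measurable => i _; rewrite -[X in measurable X]setTI.
exact: measurable_funP.
Qed.

Lemma prob_colored x : P (colored x) = (c%:R ^- n)%:E.
Proof.
have -> : colored x = [set w | forall i, i \in [set: 'I_n]%SET -> [set (x i : nat).+1] (X i w)].
  by apply/seteqP; split=> w /= H i; [move=> _|]; apply: H; rewrite ?inE.
have mB i : measurable [set (x i : nat).+1] by [].
rewrite (X_indep [set: 'I_n]%SET mB).
rewrite (eq_bigr (fun _ => (c%:R^-1)%:E)); last first.
  by move=> i _; have := X_unif i (x i).+1; rewrite ltn_ord.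
rewrite prodEFin prodr_const cardsT card_ord exprVn //.
Qed.

Lemma colored_inj (x y : Om) w : colored x w -> colored y w -> x = y.
Proof.
move=> Ax Ay; apply/ffunP => i; apply/val_inj/eqP; rewrite -eqSS; apply/eqP.
by rewrite -Ax -Ay.
Qed.

(** Each coloring has probability c^-n by independence, so together they have
    probability one, and [psi] is almost surely a simple function. *)
Lemma expectation_mean (psi : T -> R) (g : Om -> R) : measurable_fun setT psi ->
  (forall w x, colored x w -> psi w = g x) -> 'E_P[psi]%E = (mean g)%:E.
Proof.
move=> mpsi psig.
pose S w : \bar R := (\sum_(x : Om) (g x)%:E * (\1_(colored x) w)%:E)%E.
have iA x : P.-integrable setT (fun w => (\1_(colored x) w : R)%:E).
  by apply: integrable_indic; exact: measurable_colored.
have I1 x : (\int[P]_w (\1_(colored x) w)%:E = (c%:R ^- n)%:E)%E.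
  have mA := measurable_colored x; rewrite integral_indic // setIT; exact: prob_colored.
have iS x : P.-integrable setT (fun w => (g x)%:E * (\1_(colored x) w)%:E)%E.
  by apply: integrableZl => //; exact: iA.
have mS : measurable_fun setT S.
  by apply: emeasurable_sum => x; exact: measurable_int (iS x).
have IS x : (\int[P]_w ((g x)%:E * (\1_(colored x) w)%:E) = (g x * c%:R ^- n)%:E)%E.
  by rewrite integralZl // I1 -EFinM.
pose UA := \big[setU/set0]_(x : Om) colored x.
have mUA : measurable UA by apply: bigsetU_measurable => x _; exact: measurable_colored.
have S1 w : (\sum_(x : Om) (\1_(colored x) w)%:E = (\1_UA w)%:E :> \bar R)%E.
  have UAE : UA w <-> exists x, colored x w.
    rewrite /UA -bigcup_seq; split=> [[x _ ?]|[x ?]]; exists x => //.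
    by rewrite /= mem_index_enum.
  have [[x Ax]|nA] := pselect (exists x, colored x w).
    rewrite (bigD1 x) //= big1 ?adde0; last first.
      move=> y yx; rewrite indicE memNset // => Ay.
      by move: yx; rewrite (colored_inj Ax Ay) eqxx.
    by rewrite !indicE !mem_set //; apply/UAE; exists x.
  rewrite big1; last by move=> x _; rewrite indicE memNset // => Ax; apply: nA; exists x.
  by rewrite indicE memNset // => /UAE.
have PUA : P UA = 1%E.
  rewrite -[UA]setIT -integral_indic //.
  under eq_integral do rewrite -S1.
  rewrite integral_sum //.
  rewrite (eq_bigr (fun=> (c%:R ^- n)%:E)); last first.
    by move=> x _; exact: I1.
  rewrite sumEFin sumr_const card_ffun !card_ord -[_ *+ (_ ^ _)]mulr_natl natrX divff //.
  by rewrite expf_eq0 negb_and pnatr_eq0 -lt0n c0 orbT.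
have PC : P (~` UA) = 0%E by rewrite probability_setC // PUA subee.
rewrite unlock (_ : \int[P]_w (psi w)%:E = \int[P]_w S w)%E; last first.
  apply: ae_eq_integral => //; first exact/measurable_EFinP.
  exists (~` UA); split.
  - exact: measurableC.
  - exact: PC.
  - move=> w /= H; rewrite /UA -bigcup_seq => -[x _ Ax]; apply: H => _.
    rewrite (psig _ _ Ax) /S (bigD1 x) //= big1 ?adde0; last first.
      move=> y yx; rewrite indicE memNset ?mule0 // => Ay.
      by move: yx; rewrite (colored_inj Ax Ay) eqxx.
    by rewrite indicE mem_set // mule1.
rewrite integral_sum // (eq_bigr _ (fun x _ => IS x)) sumEFin /mean mulr_sumr.
by congr (_%:E); apply: eq_bigr => x _; rewrite mulrC.
Qed.
End colors.

(** * A completely degenerate form of order three *)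

Section degenerate_form.
Variables (R : realType) (n c : nat).
Hypothesis c0 : (0 < c)%N.
Notation Om := {ffun 'I_n -> 'I_c}.
Implicit Types (x y : Om) (i j k l : 'I_n).
Local Notation p := (c%:R^-1 : R).
Local Notation v := (vmatch R c).
Local Notation W := (@cmatch R n c).
Local Notation resample := (@resample R n c).
Local Notation indep_of := (@indep_of R n c).

Lemma p_ge0 : 0 <= p. Proof. by rewrite invr_ge0. Qed.

Lemma p_le1 : p <= 1. Proof. by rewrite invf_le1 ?ler1n ?ltr0n. Qed.

Lemma vmatch_ge0 : 0 <= v. Proof. by rewrite mulr_ge0 ?p_ge0 // subr_ge0 p_le1. Qed.

(** The part of the path i - j - k that survives the removal of its average over the
    middle vertex: its conditional mean vanishes in each of its three vertices. *)
Definition degen3 i k j x : R := W i j x * W j k x - c%:R^-1 * W i k x.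

Lemma indepM j (g h : Om -> R) : indep_of j g -> indep_of j h -> indep_of j (fun x => g x * h x).
Proof. by move=> Hg Hh x u; rewrite Hg Hh. Qed.

Lemma indep_degen3 i k j l : i != l -> k != l -> j != l -> indep_of l (degen3 i k j).
Proof. by move=> il kl jl x u; rewrite /degen3 !indep_cmatch. Qed.

Lemma resample_degen3 i k j l x : i != k -> i != j -> k != j -> l \in [:: i; k; j] ->
  resample l (degen3 i k j) x = 0.
Proof.
move=> ik ij kj.
have [ki ji jk] : [/\ k != i, j != i & j != k] by rewrite ![_ == i]eq_sym (eq_sym j).
rewrite !inE => /or3P[] /eqP ->.
- have -> : resample i (degen3 i k j) x = resample i
    (fun x => W j k x * W i j x + - p * W i k x) x.
    by apply: eq_resample => y; rewrite /degen3; ring.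
  rewrite resampleD resampleMl ?resampleZ ?resample_cmatchl // ?mulr0 ?addr0 //.
  exact: indep_cmatch.
- have -> : resample k (degen3 i k j) x = resample k
    (fun x => W i j x * W j k x + - p * W i k x) x.
    by apply: eq_resample => y; rewrite /degen3; ring.
  rewrite resampleD resampleMl ?resampleZ ?resample_cmatchr // ?mulr0 ?addr0 //.
  exact: indep_cmatch.
- have -> : resample j (degen3 i k j) x = resample j
    (fun x => W i j x * W j k x + - p * W i k x) x.
    by apply: eq_resample => y; rewrite /degen3; ring.
  rewrite resampleD resample_cherry // resampleZ (resample_indep c0 x (indep_cmatch _ ij kj)).
  ring.
Qed.

(** The exact value is v^2 - v / c^2. *)
Lemma mean_degen3_sqr i k j : i != k -> i != j -> k != j ->
  mean (fun x => degen3 i k j x * degen3 i k j x) <= v ^+ 2.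
Proof.
move=> ik ij kj.
have -> : mean (fun x => degen3 i k j x * degen3 i k j x) = v ^+ 2 - p ^+ 2 * v.
  transitivity (mean (fun x => v ^+ 2 + ((1 - 2 * p) * v * (W i j x + W j k x)) +
    ((1 - 2 * p) ^+ 2 * (W i j x * W j k x) + - 2 * p * (W i k x * (W i j x * W j k x))) + p ^+
      2 * (W i k x * W i k x))).
    apply: eq_mean => x; rewrite /degen3.
    have -> : (W i j x * W j k x - p * W i k x) * (W i j x * W j k x - p * W i k x) =
      W i j x ^+ 2 * W j k x ^+ 2 - 2 * p * (W i k x * (W i j x * W j k x)) + p ^+
        2 * (W i k x * W i k x) by ring.
    by rewrite !cmatch_sqr; ring.
  have mWWW : mean (fun x => W i k x * (W i j x * W j k x)) = p * v.
    rewrite -(mean_resample c0 j) -(mean_cmatch_sqr R c0 ik) -meanZ; apply: eq_mean => x.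
    rewrite resampleMl; last exact: indep_cmatch.
    by rewrite resample_cherry //; ring.
  have mWW : mean (fun x => W i j x * W j k x) = 0.
    rewrite -(mean_resample c0 j) -[RHS](mulr0 p) -(mean_cmatch R c0 ik) -meanZ.
    by apply: eq_mean => x; rewrite resample_cherry.
  rewrite !meanD !meanZ meanD mWWW mWW mean_cmatch_sqr // !mean_cmatch //; last by rewrite eq_sym.
  by rewrite mean_cst // /vmatch; ring.
by rewrite lerBlDr lerDl mulr_ge0 ?sqr_ge0 ?vmatch_ge0.
Qed.

Lemma mean_degen3_cmatch i k j l l' : i != k -> i != j -> k != j -> l != l' ->
  mean (fun x => W l l' x * degen3 i k j x) = 0.
Proof.
move=> ik ij kj ll'.
(* Some vertex of the triple is missing from the pair. *)
have [m mi ml] : exists2 m, m \in [:: i; k; j] & (m != l) && (m != l').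
  have [il|il] := boolP ((i != l) && (i != l')); first by exists i; rewrite ?inE ?eqxx.
  have [kl|kl] := boolP ((k != l) && (k != l')); first by exists k; rewrite ?inE ?eqxx ?orbT.
  exists j; first by rewrite !inE eqxx !orbT.
  move: il kl; rewrite !negb_and !negbK => /orP[] /eqP ? /orP[] /eqP ?; subst.
  - by rewrite eqxx in ik.
  - by rewrite eq_sym ij eq_sym kj.
  - by rewrite eq_sym kj eq_sym ij.
  - by rewrite eqxx in ik.
case/andP: ml => ml ml'.
apply: (@mean_kill R n c c0 m) => [|x].
  by apply: indep_cmatch; rewrite eq_sym.
exact: resample_degen3.
Qed.

Definition same_triple i k j i' k' j' : nat :=
  ([&& i' == i, k' == k & j' == j] + [&& i' == i, k' == j & j' == k]
 + [&& i' == k, k' == i & j' == j] + [&& i' == k, k' == j & j' == i]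
 + [&& i' == j, k' == i & j' == k] + [&& i' == j, k' == k & j' == i])%N.

(** If the two triples differ, a vertex of the second missing from the first can be
    recolored. Therefore no larger subgraph enters [mean_form3_sqr_le]. *)
Lemma mean_degen3M i k j i' k' j' : i != k -> i != j -> k != j ->
  i' != k' -> i' != j' -> k' != j' ->
  mean (fun x => degen3 i' k' j' x * degen3 i k j x) <= v ^+ 2 * (same_triple i k j i' k' j')%:R.
Proof.
move=> ik ij kj ik' ij' kj'.
have v2 : 0 <= v ^+ 2 by rewrite sqr_ge0.
have [/allP sub|/allPn [l lin lout]] := boolP (all (mem [:: i'; k'; j']) [:: i; k; j]);
  last first.
  suff -> : mean (fun x => degen3 i' k' j' x * degen3 i k j x) = 0 by rewrite mulr_ge0.
  apply: (@mean_kill R n c c0 l).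
  - move: lout; rewrite !inE !negb_or => /and3P[h1 h2 h3].
    by apply: indep_degen3; rewrite eq_sym.
  - by move=> x; apply: resample_degen3.
apply: (@le_trans _ _ (v ^+ 2)).
  have H1 := mean_degen3_sqr ik ij kj; have H2 := mean_degen3_sqr ik' ij' kj'.
  apply: (@le_trans _ _ (mean (fun x => 2^-1 *
    (degen3 i' k' j' x * degen3 i' k' j' x + degen3 i k j x * degen3 i k j x)))).
    apply: le_mean => x; have := sqr_ge0 (degen3 i' k' j' x - degen3 i k j x).
    move: (degen3 _ _ _ x) (degen3 _ _ _ x) => A B; rewrite expr2; lra.
  rewrite meanZ meanD; lra.
rewrite ler_peMr // ler1n.
have /= := sub i; rewrite !inE eqxx => /(_ isT) hi.
have /= := sub k; rewrite !inE eqxx orbT => /(_ isT) hk.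
have /= := sub j; rewrite !inE eqxx !orbT => /(_ isT) hj.
rewrite /same_triple.
case/or3P: hi => /eqP ?; case/or3P: hk => /eqP ?; case/or3P: hj => /eqP ?; subst;
  rewrite ?eqxx in ik ij kj *; by rewrite ?addnS ?addSn.
Qed.

Lemma sum_delta3 (a b e : 'I_n) : (\sum_i' \sum_k' \sum_j' [&& i' == a, k' == b & j' == e] = 1)%N.
Proof.
rewrite (bigD1 a) //= [X in (_ + X)%N]big1 ?addn0; last first.
  by move=> i ni; rewrite (negbTE ni); rewrite big1 // => k _; rewrite big1.
rewrite (bigD1 b) //= [X in (_ + X)%N]big1 ?addn0; last first.
  by move=> k nk; rewrite (negbTE nk); rewrite big1 // => j _; rewrite andbF.
rewrite (bigD1 e) //= [X in (_ + X)%N]big1 ?addn0; last first.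
  by move=> j nj; rewrite (negbTE nj); rewrite !andbF.
by rewrite !eqxx.
Qed.

Lemma sum_same_triple i k j : (\sum_i' \sum_k' \sum_j' same_triple i k j i' k' j' = 6)%N.
Proof.
rewrite /same_triple.
under eq_bigr => i' _ do under eq_bigr => k' _ do rewrite !big_split /=.
under eq_bigr => i' _ do rewrite !big_split /=.
rewrite !big_split /= .
by rewrite !sum_delta3.
Qed.

Lemma mean_form3_sqr_le (be : 'I_n -> 'I_n -> 'I_n -> R) :
  (forall i k j, 0 <= be i k j <= 1) ->
  (forall i k j, ~~ [&& i != k, i != j & k != j] -> be i k j = 0) ->
  mean (fun x => (\sum_i \sum_k \sum_j be i k j * degen3 i k j x) ^+ 2) <=
  6 * v ^+ 2 * \sum_i \sum_k \sum_j be i k j.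
Proof.
move=> be01 be0.
have -> : mean (fun x => (\sum_i \sum_k \sum_j be i k j * degen3 i k j x) ^+ 2) =
  \sum_i \sum_k \sum_j \sum_i' \sum_k' \sum_j' be i k j * be i' k' j' * mean
    (fun x => degen3 i' k' j' x * degen3 i k j x).
  rewrite (@eq_mean _ _ _ _ (fun x => \sum_i \sum_k \sum_j \sum_i' \sum_k' \sum_j'
    (be i k j * be i' k' j') * (degen3 i' k' j' x * degen3 i k j x))).
    do 6 (rewrite mean_sum; apply: eq_bigr => ? _).
    by rewrite meanZ.
  move=> x; rewrite expr2.
  do 3 (rewrite mulr_suml; apply: eq_bigr => ? _).
  do 3 (rewrite mulr_sumr; apply: eq_bigr => ? _).
  by ring.
rewrite mulr_sumr; apply: ler_sum => i _; rewrite mulr_sumr; apply: ler_sum => k _.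
rewrite mulr_sumr; apply: ler_sum => j _.
have [/and3P[ik ij kj]|nd] := boolP [&& i != k, i != j & k != j]; last first.
  rewrite (be0 _ _ _ nd) mulr0 big1 // => i' _; rewrite big1 // => k' _; rewrite big1 // => j' _.
  by rewrite !mul0r.
apply: (@le_trans _ _ (\sum_i' \sum_k' \sum_j' be i k j *
  (v ^+ 2 * (same_triple i k j i' k' j')%:R))).
  apply: ler_sum => i' _; apply: ler_sum => k' _; apply: ler_sum => j' _.
  have /andP[B0 B1] := be01 i k j; have /andP[B0' B1'] := be01 i' k' j'.
  rewrite -mulrA; apply: ler_wpM2l => //.
  have v2 : 0 <= v ^+ 2 * (same_triple i k j i' k' j')%:R by rewrite mulr_ge0 ?sqr_ge0.
  have [/and3P[ik' ij' kj']|nd] := boolP [&& i' != k', i' != j' & k' != j']; last first.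
    by rewrite (be0 _ _ _ nd) mul0r.
  apply: le_trans (ler_wpM2l B0' (mean_degen3M ik ij kj ik' ij' kj')) _.
  by rewrite ler_piMl.
rewrite le_eqVlt; apply/orP; left; apply/eqP.
transitivity (be i k j * v ^+ 2 * (\sum_i' \sum_k' \sum_j' same_triple i k j i' k' j')%N%:R);
  last first.
  by rewrite sum_same_triple; ring.
rewrite natr_sum mulr_sumr; apply: eq_bigr => i' _.
rewrite natr_sum mulr_sumr; apply: eq_bigr => k' _.
by rewrite natr_sum mulr_sumr; apply: eq_bigr => j' _; rewrite mulrA.
Qed.
End degenerate_form.

(** * Stein's method for a recolored vertex *)

Section expansions.
Variable R : realType.

Lemma taylor1 (f f' : R -> R) : (forall x : R, is_derive x 1 f (f' x)) ->
  (forall x y, `|f' x - f' y| <= 2 * `|x - y|) ->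
  forall x y, `|f y - f x - f' x * (y - x)| <= (y - x) ^+ 2.
Proof.
move=> Df L x y.
have D (s : R) (r : R) (t : R) : is_derive t 1
  (fun t => r * (s * (f t - f' x * t) - (t - x) * (t - x)))
   (r * (s * (f' t - f' x) - 2 * (t - x))).
  apply: (is_derive_eq (is_derive_mul (is_derive_const r t)
    (is_derive_add (is_derive_mul (is_derive_const s t)
    (is_derive_add (Df t) (is_derive_neg (is_derive_mul (is_derive_const (f' x) t)
    (is_derive_idf t)))))
   (is_derive_neg (is_derive_mul (is_derive_add (is_derive_idf t) (is_derive_const (-x) t))
     (is_derive_add (is_derive_idf t) (is_derive_const (-x) t))))))) => /=.
  ring.
have key s : `|s| = 1 -> s * (f y - f x - f' x * (y - x)) <= (y - x) ^+ 2.
  move=> s1.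
  have B t : `|s * (f' t - f' x)| <= 2 * `|t - x| by rewrite normrM s1 mul1r.
  have [xy|/ltW yx] := leP x y.
    have := le_of_derive_le0 (D s 1) xy; rewrite !mul1r subrr mul0r subr0.
    suff H : forall t, x <= t <= y -> 1 * (s * (f' t - f' x) - 2 * (t - x)) <= 0.
      by move=> /(_ H); lra.
    move=> t /andP[xt _]; have := B t; rewrite (ger0_norm (_ : 0 <= t - x)) ?subr_ge0 //.
    by rewrite ler_norml; lra.
  have := le_of_derive_le0 (D s (-1)) yx; rewrite !mulN1r subrr mul0r subr0.
  suff H : forall t, y <= t <= x -> - (s * (f' t - f' x) - 2 * (t - x)) <= 0.
    move=> H2; have : - (s * (f x - f' x * x)) <= - (s * (f y - f' x * y) - (y - x) * (y - x)).
      by apply: H2 => t ht; rewrite mulN1r; exact: H.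
    lra.
  move=> t /andP[_ tx]; have := B t; rewrite (ler0_norm (_ : t - x <= 0)) ?subr_le0 //.
  by rewrite ler_norml; lra.
have := key 1 (normr1 _); have := key (-1) (normrN1 _).
by rewrite ler_norml; lra.
Qed.

(** Expanding from both ends to the midpoint halves the error of [taylor1]. *)
Lemma trapezoid (f f' : R -> R) : (forall x : R, is_derive x 1 f (f' x)) ->
  (forall x y, `|f' x - f' y| <= 2 * `|x - y|) ->
  forall x y, `|(f x - f y) - (x - y) * ((f' x + f' y) / 2)| <= (x - y) ^+ 2 / 2.
Proof.
move=> Df L x y; have T := taylor1 Df L; pose m := (x + y) / 2.
have := T x m; have := T y m.
have -> : m - x = - ((x - y) / 2) by rewrite /m; field.
have -> : m - y = (x - y) / 2 by rewrite /m; field.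
rewrite !ler_norml; move: (f m) (f x) (f y) (f' x) (f' y) => a1 a2 a3 a4 a5.
have -> : (x - y) ^+ 2 / 2 = ((x - y) / 2) ^+ 2 + (- ((x - y) / 2)) ^+ 2 by field.
move: (((x - y) / 2) ^+ 2) ((- ((x - y) / 2)) ^+ 2) => q1 q2. lra.
Qed.

(** A nonnegative quadratic polynomial has a nonpositive discriminant. *)
Lemma sqrt_discr_le (a b z : R) : 0 <= a -> 0 <= b ->
  (forall t, 0 <= a - 2 * t * z + t ^+ 2 * b) ->
  z <= Num.sqrt a * Num.sqrt b.
Proof.
move=> a0 b0 H; have [z0|z0] := leP z 0; first by rewrite (le_trans z0) // mulr_ge0.
have bp : 0 < b.
  rewrite lt_neqAle b0 andbT; apply/eqP => b00.
  have := H ((a + 1) / (2 * z)); rewrite -b00 mulr0 addr0.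
  have -> : 2 * ((a + 1) / (2 * z)) * z = a + 1 by field; rewrite gt_eqF.
  lra.
rewrite -sqrtrM // -[z]gtr0_norm // -sqrtr_sqr ler_wsqrtr //.
have := H (z / b).
have -> : a - 2 * (z / b) * z + (z / b) ^+ 2 * b = (a * b - z ^+ 2) / b by field; rewrite gt_eqF.
by rewrite pmulr_lge0 ?invr_gt0 // subr_ge0.
Qed.
End expansions.

Section exchangeable_pair.
Variables (R : realType) (n c : nat).
Hypothesis c0 : (0 < c)%N.
Notation Om := {ffun 'I_n -> 'I_c}.
Implicit Types (x y : Om) (i j k l : 'I_n) (K L : Om -> Om -> R).
Local Notation resample := (@resample R n c).

(** The expectation over the exchangeable pair formed by a uniform coloring and the
    same coloring with the color of [j] drawn anew. *)
Definition pair_mean j K : R := mean (fun x => c%:R^-1 * \sum_u K x (recolor x j u)).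

Lemma pair_meanC j K : pair_mean j K = pair_mean j (fun x y => K y x).
Proof. exact: resample_swap. Qed.

Lemma eq_pair_mean j K L : (forall x u, K x (recolor x j u) = L x (recolor x j u)) ->
  pair_mean j K = pair_mean j L.
Proof. by move=> e; apply: eq_mean => x; congr (_ * _); apply: eq_bigr. Qed.

Lemma pair_meanD j K L : pair_mean j (fun x y => K x y + L x y) = pair_mean j K + pair_mean j L.
Proof. by rewrite -meanD; apply: eq_mean => x; rewrite big_split mulrDr. Qed.

Lemma pair_meanZ j a K : pair_mean j (fun x y => a * K x y) = a * pair_mean j K.
Proof. by rewrite -meanZ; apply: eq_mean => x; rewrite -mulr_sumr mulrCA. Qed.

Lemma le_pair_mean j K L : (forall x u, K x (recolor x j u) <= L x (recolor x j u)) ->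
  pair_mean j K <= pair_mean j L.
Proof.
by move=> e; apply: le_mean => x; rewrite ler_wpM2l ?invr_ge0 //; apply: ler_sum.
Qed.

Lemma pair_mean_ge0 j K : (forall x y, 0 <= K x y) -> 0 <= pair_mean j K.
Proof.
by move=> H; apply: (mean_ge0 c0) => x; rewrite mulr_ge0 ?invr_ge0 //; apply: sumr_ge0.
Qed.

Lemma pair_meanMl j (g h : Om -> R) : pair_mean j (fun x y => g x * h y) =
  mean (fun x => g x * resample j h x).
Proof. by apply: eq_mean => x; rewrite -mulr_sumr mulrCA. Qed.

Lemma pair_mean_fst j (g : Om -> R) : pair_mean j (fun x _ => g x) = mean g.
Proof.
apply: eq_mean => x; rewrite sumr_const card_ord -[g x *+ c]mulr_natl mulKf //.
by rewrite pnatr_eq0 -lt0n.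
Qed.

Lemma pair_mean_snd j (g : Om -> R) : pair_mean j (fun _ y => g y) = mean g.
Proof. by rewrite pair_meanC pair_mean_fst. Qed.

Lemma mean_CS (A B : Om -> R) :
  mean (fun x => A x * B x) <= Num.sqrt (mean (fun x => A x ^+ 2)) * Num.sqrt
    (mean (fun x => B x ^+ 2)).
Proof.
apply: sqrt_discr_le => [||t]; try by apply: (mean_ge0 c0) => x; exact: sqr_ge0.
have : 0 <= mean (fun x => (A x - t * B x) ^+ 2) by apply: (mean_ge0 c0) => x; exact: sqr_ge0.
rewrite (_ : mean (fun x => (A x - t * B x) ^+ 2) =
  mean (fun x => A x ^+ 2 + ((- 2 * t) * (A x * B x) + t ^+ 2 * B x ^+ 2))); last first.
  by apply: eq_mean => x; ring.
rewrite !meanD !meanZ; lra.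
Qed.

Lemma pair_mean_CS (A B : 'I_n -> Om -> Om -> R) :
  \sum_j pair_mean j (fun x y => A j x y * B j x y) <=
  Num.sqrt (\sum_j pair_mean j (fun x y => A j x y ^+ 2)) * Num.sqrt
    (\sum_j pair_mean j (fun x y => B j x y ^+ 2)).
Proof.
apply: sqrt_discr_le => [||t]; try by apply: sumr_ge0 => j _; apply: pair_mean_ge0 => x y;
  exact: sqr_ge0.
have : 0 <= \sum_j pair_mean j (fun x y => (A j x y - t * B j x y) ^+ 2).
  by apply: sumr_ge0 => j _; apply: pair_mean_ge0 => x y; exact: sqr_ge0.
rewrite (eq_bigr (fun j => pair_mean j (fun x y => A j x y ^+ 2) +
  ((- 2 * t) * pair_mean j (fun x y => A j x y * B j x y) + t ^+
  2 * pair_mean j (fun x y => B j x y ^+ 2)))).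
  rewrite !big_split /= -!mulr_sumr; lra.
move=> j _; rewrite -!pair_meanZ -!pair_meanD; apply: eq_pair_mean => x u; ring.
Qed.

Variables (U : 'I_n -> Om -> R) (F : Om -> R).
Hypothesis resU : forall j x, resample j (U j) x = 0.

(** In the expanded product two terms equal the left-hand side by exchangeability, and
    the two mixed ones vanish because [U j] averages to zero over the color of [j]. Nothing
    is asked of the dependence of [F] on that color. *)
Lemma exchange_stein j (f : R -> R) :
  mean (fun x => U j x * f (F x)) =
  2^-1 * pair_mean j (fun x y => (U j x - U j y) * (f (F x) - f (F y))).
Proof.
have -> : pair_mean j (fun x y => (U j x - U j y) * (f (F x) - f (F y))) =
  pair_mean j (fun x _ => U j x * f (F x)) + (pair_mean j (fun _ y => U j y * f (F y))
   + (-1 * pair_mean j (fun x y => U j x * f (F y)) +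
       -1 * pair_mean j (fun x y => f (F x) * U j y))).
  by rewrite -!pair_meanZ -!pair_meanD; apply: eq_pair_mean => x u; ring.
rewrite pair_mean_fst pair_mean_snd (pair_meanC j (fun x y => U j x * f (F y))).
have Z : pair_mean j (fun x y => f (F x) * U j y) = 0.
  rewrite pair_meanMl -[RHS](mean_cst n c0 0); apply: eq_mean => x; by rewrite resU mulr0.
have -> : pair_mean j (fun x y => U j y * f (F x)) = 0.
  by rewrite -[RHS]Z; apply: eq_pair_mean => x u; rewrite mulrC.
by rewrite Z; field.
Qed.

Variables (f f' : R -> R) (K1 : R).
Hypothesis Df : forall x : R, is_derive x 1 f (f' x).
Hypothesis bf' : forall t : R, `|f' t| <= K1.
Hypothesis lf' : forall s t : R, `|f' s - f' t| <= 2 * `|s - t|.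
Hypothesis FU : forall x, F x = \sum_j U j x.
Let K10 : 0 <= K1. Proof. exact: le_trans (normr_ge0 (f' 0)) (bf' 0). Qed.

(** Half the sum over [j] of the conditional mean, given the coloring, of the product of
    the increments of [U j] and [F]; its own mean is the second moment of [F]. *)
Definition carre_du_champ x : R :=
  2^-1 * \sum_j (c%:R^-1 * \sum_u (U j x - U j (recolor x j u)) * (F x - F (recolor x j u))).

(** By [trapezoid] the increment of [f] is the increment of [F] times the average of [f']
    at the two ends. The product of the two increments being symmetric, that average may be
    replaced by [f' (F x)], which produces [carre_du_champ]. In the remainder, writing the
    cubic term as |dF| * |dU dF| before Cauchy-Schwarz leaves only two increments of [F] in
    the fourth moment. *)
Lemma stein_pair_bound :
  `|mean (fun x => f' (F x) - F x * f (F x))| <=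
  K1 * Num.sqrt (mean (fun x => (1 - carre_du_champ x) ^+ 2)) +
  4^-1 * (Num.sqrt (\sum_j pair_mean j (fun x y => (F x - F y) ^+ 2)) *
          Num.sqrt (\sum_j pair_mean j (fun x y => ((U j x - U j y) * (F x - F y)) ^+ 2))).
Proof.
pose rem x y := (f (F x) - f (F y)) - (F x - F y) * ((f' (F x) + f' (F y)) / 2).
have E1 : mean (fun x => F x * f (F x)) = mean (fun x => f' (F x) * carre_du_champ x) +
    2^-1 * \sum_j pair_mean j (fun x y => (U j x - U j y) * rem x y).
  transitivity (\sum_j mean (fun x => U j x * f (F x))).
    by rewrite -mean_sum; apply: eq_mean => x; rewrite {1}FU mulr_suml.
  transitivity (\sum_j (2^-1 * pair_mean j (fun x y => f' (F x) * ((U j x - U j y) * (F x - F y)))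
     + 2^-1 * pair_mean j (fun x y => (U j x - U j y) * rem x y))).
    apply: eq_bigr => j _; rewrite exchange_stein -mulrDr; congr (_ * _).
    have -> : pair_mean j (fun x y => f' (F x) * ((U j x - U j y) * (F x - F y))) =
      2^-1 * (pair_mean j (fun x y => f' (F x) * ((U j x - U j y) * (F x - F y))) +
       pair_mean j (fun x y => f' (F y) * ((U j x - U j y) * (F x - F y)))).
      rewrite [X in _ + X]pair_meanC.
      rewrite (@eq_pair_mean j (fun x y => f' (F x) * ((U j y - U j x) * (F y - F x)))
        (fun x y => f' (F x) * ((U j x - U j y) * (F x - F y)))).
        by field.
      by move=> x u; ring.
    rewrite -pair_meanD -pair_meanZ -pair_meanD; apply: eq_pair_mean => x u; rewrite /rem;
      by field.
  rewrite big_split /=; congr (_ + _); last by rewrite -mulr_sumr.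
  rewrite -mulr_sumr /pair_mean -mean_sum -meanZ; apply: eq_mean => x; rewrite /carre_du_champ.
  rewrite mulrCA; congr (_ * _); rewrite mulr_sumr; apply: eq_bigr => j _.
  by rewrite -mulr_sumr mulrCA.
have -> : mean (fun x => f' (F x) - F x * f (F x)) =
  mean (fun x => f' (F x) * (1 - carre_du_champ x)) - 2^-1 * \sum_j pair_mean j
    (fun x y => (U j x - U j y) * rem x y).
  rewrite meanD meanN E1.
  rewrite (@eq_mean _ _ _ (fun x => f' (F x) * (1 - carre_du_champ x))
    (fun x => f' (F x) + - (f' (F x) * carre_du_champ x))).
    by rewrite meanD meanN; ring.
  by move=> x; ring.
apply: le_trans (ler_normB _ _) _; apply: lerD.
  apply: (@le_trans _ _ (K1 * mean (fun x => 1 * `|1 - carre_du_champ x|))).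
    have ub (g h : Om -> R) : (forall x, `|g x| <= h x) -> `|mean g| <= mean h.
      move=> gh; rewrite ler_norml -meanN; apply/andP; split; apply: le_mean => x;
       have := gh x; rewrite ler_norml; lra.
    rewrite -meanZ; apply: ub => x; rewrite normrM mul1r ler_wpM2r //.
  apply: ler_wpM2l => //; apply: le_trans (mean_CS _ _) _.
  rewrite expr1n mean_cst // sqrtr1 mul1r.
  rewrite (@eq_mean _ _ _ (fun x => `|1 - carre_du_champ x| ^+ 2)
    (fun x => (1 - carre_du_champ x) ^+ 2)) //.
  by move=> x; rewrite real_normK ?num_real.
rewrite normrM ger0_norm ?invr_ge0 //.
have -> : (4^-1 : R) = 2^-1 * 2^-1 by field.
rewrite -mulrA; apply: ler_wpM2l; rewrite ?invr_ge0 //.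
apply: (@le_trans _ _ (2^-1 * \sum_j pair_mean j
  (fun x y => `|F x - F y| * `|(U j x - U j y) * (F x - F y)|))).
  apply: le_trans (ler_norm_sum _ _ _) _; rewrite mulr_sumr; apply: ler_sum => j _.
  rewrite -pair_meanZ ler_norml -[- pair_mean _ _]mulN1r -pair_meanZ.
  have B x y : `|(U j x - U j y) * rem x y| <=
    2^-1 * (`|F x - F y| * `|(U j x - U j y) * (F x - F y)|).
    rewrite !normrM; have := trapezoid Df lf' (F x) (F y); rewrite -/(rem x y) => h.
    apply: le_trans (ler_wpM2l (normr_ge0 _) h) _.
    rewrite -(real_normK (num_real (F x - F y))) le_eqVlt; apply/orP; left; apply/eqP; ring.
  by apply/andP; split; apply: le_pair_mean => x u; have := B x (recolor x j u);
    rewrite ler_norml ?mulN1r => /andP[].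
apply: ler_wpM2l; rewrite ?invr_ge0 //.
apply: le_trans (pair_mean_CS _ _) _.
rewrite le_eqVlt; apply/orP; left; apply/eqP; congr (Num.sqrt _ * Num.sqrt _);
  apply: eq_bigr => j _; apply: eq_pair_mean => x u.
  by rewrite real_normK ?num_real.
by rewrite real_normK ?num_real.
Qed.
End exchangeable_pair.

(** * Fourth moments of a recoloring *)

Section fourth_moments.
Variables (R : realType) (n c : nat).
Hypothesis c0 : (0 < c)%N.
Notation Om := {ffun 'I_n -> 'I_c}.
Implicit Types (x y : Om) (i j k l : 'I_n) (u : 'I_c).
Local Notation p := (c%:R^-1 : R).
Local Notation v := (vmatch R c).
Local Notation W := (@cmatch R n c).
Local Notation resample := (@resample R n c).
Local Notation indep_of := (@indep_of R n c).

Definition mdiff j u i x : R := (x i == x j)%:R - (x i == u)%:R.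

Lemma mdiffE j u i x : i != j -> W i j x - W i j (recolor x j u) = mdiff j u i x.
Proof. by move=> ij; rewrite /W /mdiff recolorE recolorNE //; ring. Qed.

Lemma resample_eqc i u x : resample i (fun x => (x i == u)%:R) x = p.
Proof.
rewrite /resample (eq_bigr (fun w => (u == w)%:R * 1)).
  by rewrite sum_eq mulr1.
by move=> w _; rewrite recolorE mulr1 eq_sym.
Qed.

Lemma resample_eql i j x : i != j -> resample i (fun x => (x i == x j)%:R) x = p.
Proof.
move=> ij; rewrite -[RHS](resample_eq R (j := i) (i := j) x) 1?eq_sym //.
by apply: eq_resample => y; rewrite eq_sym.
Qed.

Lemma resample_mdiff i j u x : i != j -> resample i (mdiff j u i) x = 0.
Proof.
move=> ij; rewrite (@eq_resample _ _ _ _ _ (fun x => (x i == x j)%:R + -1 * (x i == u)%:R)).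
  by rewrite resampleD resampleZ resample_eql // resample_eqc; ring.
by move=> y; rewrite /mdiff; ring.
Qed.

Lemma indep_mdiff i j k u : k != i -> j != i -> indep_of i (mdiff j u k).
Proof. by move=> ki ji x w; rewrite /mdiff !recolorNE. Qed.

Definition neq_ind j u x : R := 1 - (x j == u)%:R.

Lemma neq_ind_sqr j u x : neq_ind j u x * neq_ind j u x = neq_ind j u x.
Proof. by rewrite /neq_ind; case: eqP => _ /=; ring. Qed.

Lemma resample_mdiff_sqr i j u x : i != j ->
  resample i (fun x => mdiff j u i x * mdiff j u i x) x = 2 * p * neq_ind j u x.
Proof.
move=> ij; rewrite (@eq_resample _ _ _ _ _ (fun x => (x j == u)%:R * (-2 * (x i == u)%:R) +
  ((x i == x j)%:R + (x i == u)%:R))).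
  rewrite !resampleD resampleMl; last by move=> y w; rewrite recolorNE // eq_sym.
  by rewrite resampleZ resample_eql // resample_eqc /neq_ind; ring.
move=> y; rewrite /mdiff; have [->|yu] := eqVneq (y j) u; first by case: eqP => _ /=; ring.
have [yj|yj] := eqVneq (y i) (y j); last by case: eqP => _ /=; ring.
by rewrite yj (negbTE yu) /=; ring.
Qed.

Lemma mean_neq_ind j u : mean (neq_ind j u) = 1 - p.
Proof.
rewrite -(mean_resample c0 j) -[RHS](mean_cst n c0); apply: eq_mean => x.
rewrite (@eq_resample _ _ _ _ _ (fun x => 1 + -1 * (x j == u)%:R)).
  by rewrite resampleD resampleZ resample_eqc (resample_indep c0 _ (indep_cst _ _)); ring.
by move=> y; rewrite /neq_ind; ring.
Qed.

Lemma mean_mdiff_sqr i j u : i != j -> mean (fun x => mdiff j u i x * mdiff j u i x) = 2 * v.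
Proof.
move=> ij; rewrite -(mean_resample c0 i) (@eq_mean _ _ _ _ (fun x => 2 * p * neq_ind j u x)).
  by rewrite meanZ mean_neq_ind /vmatch; ring.
by move=> x; exact: resample_mdiff_sqr.
Qed.

Lemma mean_mdiff_sqrM i k j u : i != j -> k != j -> i != k ->
  mean (fun x => (mdiff j u i x * mdiff j u i x) * (mdiff j u k x * mdiff j u k x)) = 4 * p * v.
Proof.
move=> ij kj ik; rewrite -(mean_resample c0 k).
rewrite (@eq_mean _ _ _ _ (fun x => 2 * p * (neq_ind j u x * (mdiff j u i x * mdiff j u i x))));
  last first.
  move=> x; rewrite resampleMl; last by apply: indepM; apply: indep_mdiff; rewrite // eq_sym.
  by rewrite resample_mdiff_sqr //; ring.
rewrite meanZ -(mean_resample c0 i) (@eq_mean _ _ _ _ (fun x => 2 * p * neq_ind j u x)).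
  by rewrite meanZ mean_neq_ind /vmatch; ring.
move=> x; rewrite resampleMl; last by move=> y w; rewrite /neq_ind recolorNE // eq_sym.
by rewrite resample_mdiff_sqr // mulrCA neq_ind_sqr.
Qed.

Definition mean_mdiff4 j u i1 i2 i3 i4 : R :=
  mean (fun x => mdiff j u i1 x * mdiff j u i2 x * (mdiff j u i3 x * mdiff j u i4 x)).

Lemma mean_mdiff4_single j u i1 i2 i3 i4 : i1 != j -> i2 != j -> i3 != j -> i4 != j ->
  i1 != i2 -> i1 != i3 -> i1 != i4 -> mean_mdiff4 j u i1 i2 i3 i4 = 0.
Proof.
move=> h1 h2 h3 h4 h5 h6 h7.
rewrite /mean_mdiff4 (@eq_mean _ _ _ _ (fun x =>
  (mdiff j u i2 x * (mdiff j u i3 x * mdiff j u i4 x)) * mdiff j u i1 x)); last first.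
  by move=> x; ring.
apply: (@mean_kill _ _ _ c0 i1); last by move=> x; exact: resample_mdiff.
by apply: indepM; [|apply: indepM]; apply: indep_mdiff; rewrite // eq_sym.
Qed.

Definition mdiff4_bound i1 i2 i3 i4 : R :=
  2 * v * ([&& i1 == i2, i1 == i3 & i1 == i4])%:R +
  4 * p * v * (((i1 == i2) && (i3 == i4))%:R + ((i1 == i3) && (i2 == i4))%:R +
    ((i1 == i4) && (i2 == i3))%:R).

(** A vertex occurring once can be recolored, which gives zero. What remains is the
    coincidence of all four indices and the three pairings. *)
Lemma mean_mdiff4_le j u i1 i2 i3 i4 : i1 != j -> i2 != j -> i3 != j -> i4 != j ->
  mean_mdiff4 j u i1 i2 i3 i4 <= mdiff4_bound i1 i2 i3 i4.
Proof.
move=> h1 h2 h3 h4.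
have v0 := vmatch_ge0 R c0; have pv0 : 0 <= p * v by rewrite mulr_ge0 ?p_ge0.
have B0 : 0 <= mdiff4_bound i1 i2 i3 i4.
  rewrite /mdiff4_bound; apply: addr_ge0; first by apply: mulr_ge0 => //; apply: mulr_ge0.
  apply: mulr_ge0; first by rewrite -mulrA; apply: mulr_ge0.
  by apply: addr_ge0 => //; apply: addr_ge0.
have C (w : R) (H : w = mean_mdiff4 j u i1 i2 i3 i4) : w <= mdiff4_bound i1 i2 i3 i4 ->
  mean_mdiff4 j u i1 i2 i3 i4 <= mdiff4_bound i1 i2 i3 i4.
  by rewrite H.
have Z : mean_mdiff4 j u i1 i2 i3 i4 = 0 -> mean_mdiff4 j u i1 i2 i3 i4 <=
  mdiff4_bound i1 i2 i3 i4 by move=> ->.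
(* Bring any of the four indices to the front. *)
have p2 : mean_mdiff4 j u i1 i2 i3 i4 = mean_mdiff4 j u i2 i1 i3 i4 by apply: eq_mean => x; ring.
have p3 : mean_mdiff4 j u i1 i2 i3 i4 = mean_mdiff4 j u i3 i1 i2 i4 by apply: eq_mean => x; ring.
have p4 : mean_mdiff4 j u i1 i2 i3 i4 = mean_mdiff4 j u i4 i1 i2 i3 by apply: eq_mean => x; ring.
have pr a b : a != j -> b != j -> a != b -> mean
  (fun x => mdiff j u a x * mdiff j u a x * (mdiff j u b x * mdiff j u b x)) = 4 * p * v.
  by move=> *; rewrite mean_mdiff_sqrM.
have [e2|n2] := eqVneq i1 i2; have [e3|n3] := eqVneq i1 i3; have [e4|n4] := eqVneq i1 i4.
- subst; rewrite /mean_mdiff4 /mdiff4_bound !eqxx /=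
    (@eq_mean _ _ _ _ (fun x => mdiff j u i4 x * mdiff j u i4 x)).
    by rewrite mean_mdiff_sqr //; lra.
  by move=> x; rewrite /mdiff; do 2 case: eqP => _ /=; ring.
- by apply: Z; rewrite p4; subst; apply: mean_mdiff4_single; rewrite // eq_sym.
- by apply: Z; rewrite p3; subst; apply: mean_mdiff4_single; rewrite // eq_sym.
- subst; have [e34|n34] := eqVneq i3 i4; last by apply: Z; rewrite p3;
    apply: mean_mdiff4_single; rewrite // eq_sym.
  subst; rewrite /mean_mdiff4 pr // /mdiff4_bound !eqxx (negbTE n4) /=; lra.
- by apply: Z; rewrite p2; subst; apply: mean_mdiff4_single; rewrite // eq_sym.
- subst; have [e34|n34] := eqVneq i2 i4; last by apply: Z; rewrite p2;
    apply: mean_mdiff4_single; rewrite // eq_sym.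
  subst; apply: (C (4 * p * v)); last by rewrite /mdiff4_bound !eqxx (negbTE n4) /=; lra.
  by rewrite -(pr i3 i4) //; apply: eq_mean => x; ring.
- subst; have [e34|n34] := eqVneq i2 i3; last by apply: Z; rewrite p2;
    apply: mean_mdiff4_single; rewrite // eq_sym.
  subst; apply: (C (4 * p * v)); last by rewrite /mdiff4_bound !eqxx (negbTE n3) /=; lra.
  by rewrite -(pr i4 i3) //; apply: eq_mean => x; ring.
- by apply: Z; apply: mean_mdiff4_single.
Qed.

Lemma mean_mdiff_forms_le j u (g h : 'I_n -> R) : (forall i, 0 <= g i) -> (forall i, 0 <= h i) ->
  g j = 0 -> h j = 0 ->
  mean (fun x => ((\sum_i g i * mdiff j u i x) * (\sum_k h k * mdiff j u k x)) ^+ 2) <=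
  2 * v * (\sum_i g i ^+ 2 * h i ^+ 2) +
  4 * p * v * ((\sum_i g i ^+ 2) * (\sum_k h k ^+ 2) + 2 * (\sum_i g i * h i) ^+ 2).
Proof.
move=> g0 h0 gj hj.
have -> : mean (fun x => ((\sum_i g i * mdiff j u i x) * (\sum_k h k * mdiff j u k x)) ^+ 2) =
  \sum_i1 \sum_i2 \sum_i3 \sum_i4 g i1 * g i2 * (h i3 * h i4) * mean_mdiff4 j u i1 i2 i3 i4.
  rewrite (@eq_mean _ _ _ _ (fun x => \sum_i1 \sum_i2 \sum_i3 \sum_i4
    (g i1 * g i2 * (h i3 * h i4)) * (mdiff j u i1 x * mdiff j u i2 x *
    (mdiff j u i3 x * mdiff j u i4 x)))).
    do 4 (rewrite mean_sum; apply: eq_bigr => ? _).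
    by rewrite meanZ.
  move=> x; rewrite exprMn !expr2 [X in X * _]big_distrlr [X in _ * X]big_distrlr /=.
  rewrite mulr_suml; apply: eq_bigr => i1 _; rewrite mulr_suml; apply: eq_bigr => i2 _.
  rewrite mulr_sumr; apply: eq_bigr => i3 _; rewrite mulr_sumr; apply: eq_bigr => i4 _.
  by ring.
apply: (@le_trans _ _ (\sum_i1 \sum_i2 \sum_i3 \sum_i4 g i1 * g i2 * (h i3 * h i4) *
  mdiff4_bound i1 i2 i3 i4)).
  apply: ler_sum => i1 _; apply: ler_sum => i2 _; apply: ler_sum => i3 _; apply: ler_sum => i4 _.
  have [->|n1] := eqVneq i1 j; first by rewrite gj !mul0r.
  have [->|n2] := eqVneq i2 j; first by rewrite gj mulr0 !mul0r.
  have [->|n3] := eqVneq i3 j; first by rewrite hj mul0r mulr0 !mul0r.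
  have [->|n4] := eqVneq i4 j; first by rewrite hj !mulr0 !mul0r.
  by apply: ler_wpM2l; rewrite ?mean_mdiff4_le // !mulr_ge0.
rewrite le_eqVlt; apply/orP; left; apply/eqP.
have S4 (G : 'I_n -> 'I_n -> 'I_n -> 'I_n -> R) i1 :
  \sum_i2 \sum_i3 \sum_i4 G i1 i2 i3 i4 * ([&& i1 == i2, i1 == i3 & i1 == i4])%:R = G i1 i1 i1 i1.
  rewrite -[RHS](sum_delta (fun i2 => G i1 i2 i1 i1) i1); apply: eq_bigr => i2 _.
  rewrite -[G i1 i2 i1 i1](sum_delta (fun i3 => G i1 i2 i3 i1) i1) mulr_sumr;
    apply: eq_bigr => i3 _.
  rewrite -[G i1 i2 i3 i1](sum_delta (fun i4 => G i1 i2 i3 i4) i1) !mulr_sumr;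
    apply: eq_bigr => i4 _.
  by rewrite !(eq_sym i1) -!mulnb !natrM; ring.
transitivity (\sum_i1 (2 * v * (\sum_i2 \sum_i3 \sum_i4 g i1 * g i2 * (h i3 * h i4) *
  ([&& i1 == i2, i1 == i3 & i1 == i4])%:R) +
   4 * p * v * (\sum_i2 (i2 == i1)%:R * (\sum_i3 \sum_i4 (i4 == i3)%:R *
     (g i1 * g i2 * (h i3 * h i4)))
    + \sum_i2 \sum_i3 (i3 == i1)%:R * (\sum_i4 (i4 == i2)%:R * (g i1 * g i2 * (h i3 * h i4)))
    + \sum_i2 \sum_i3 (i3 == i2)%:R * (\sum_i4 (i4 == i1)%:R * (g i1 * g i2 * (h i3 * h i4)))))).
  apply: eq_bigr => i1 _; rewrite -!big_split /= !mulr_sumr -!big_split /=;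
    apply: eq_bigr => i2 _.
  rewrite !mulr_sumr -!big_split /= !mulr_sumr -!big_split /=; apply: eq_bigr => i3 _.
  rewrite !mulr_sumr -!big_split /= !mulr_sumr -!big_split /=; apply: eq_bigr => i4 _.
  rewrite /mdiff4_bound (eq_sym i1 i2) (eq_sym i3 i4) (eq_sym i1 i3) (eq_sym i2 i4)
    (eq_sym i1 i4) (eq_sym i2 i3).
  by rewrite -!mulnb !natrM; ring.
rewrite big_split /= -!mulr_sumr; congr (_ * _ + _ * _).
  by apply: eq_bigr => i1 _; rewrite (S4 (fun i1 i2 i3 i4 => g i1 * g i2 * (h i3 * h i4))); ring.
rewrite !big_split /= -addrA; congr (_ + _).
  rewrite mulr_suml; apply: eq_bigr => i1 _; rewrite sum_delta mulr_sumr; apply: eq_bigr => i3 _.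
  by rewrite sum_delta; ring.
rewrite mulr2n mulrDl mul1r expr2 mulr_suml -!big_split; apply: eq_bigr => i1 _ /=.
rewrite mulr_sumr -!big_split /=; apply: eq_bigr => i2 _.
rewrite !sum_delta; ring.
Qed.
End fourth_moments.

(** * Monochromatic edges of an oriented graph *)

Section oriented_graph.
Variables (R : realType) (n c : nat).
Hypothesis c0 : (0 < c)%N.
Notation Om := {ffun 'I_n -> 'I_c}.
Implicit Types (x y : Om) (i j k l : 'I_n) (u : 'I_c).
Local Notation p := (c%:R^-1 : R).
Local Notation v := (vmatch R c).
Local Notation W := (@cmatch R n c).
Local Notation resample := (@resample R n c).
Variables (b : 'I_n -> 'I_n -> R) (m r : R).
Hypothesis hb2 : forall i j, b i j * b i j = b i j.
Hypothesis hbb : forall i j, b i j * b j i = 0.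
Hypothesis hm : \sum_j \sum_i b i j = m.

Definition edge i j : R := b i j + b j i.

Definition indeg j : R := \sum_i b i j.
Hypothesis hr : forall j, indeg j <= r.

Lemma bii i : b i i = 0. Proof. by rewrite -hb2 hbb. Qed.

Lemma b_ge0 i j : 0 <= b i j. Proof. by rewrite -hb2 -expr2 sqr_ge0. Qed.

Lemma b_le1 i j : b i j <= 1.
Proof.
have : 0 <= (1 - b i j) ^+ 2 by exact: sqr_ge0.
by have := hb2 i j; rewrite expr2; lra.
Qed.

Lemma edgeC i j : edge i j = edge j i. Proof. by rewrite /edge addrC. Qed.

Lemma edgeii i : edge i i = 0. Proof. by rewrite /edge bii addr0. Qed.

Lemma edge_ge0 i j : 0 <= edge i j. Proof. by rewrite addr_ge0 ?b_ge0. Qed.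

Lemma edge2 i j : edge i j * edge i j = edge i j.
Proof.
rewrite /edge; have := hb2 i j; have := hb2 j i; have := hbb i j; lra.
Qed.

Lemma edge_le1 i j : edge i j <= 1.
Proof.
have : 0 <= (1 - edge i j) ^+ 2 by exact: sqr_ge0.
by have := edge2 i j; rewrite expr2; lra.
Qed.

Lemma b_edge i j : b i j * edge i j = b i j.
Proof. by rewrite /edge mulrDr hb2 hbb addr0. Qed.

Lemma b_le_edge i j : b i j <= edge i j. Proof. by rewrite lerDl b_ge0. Qed.

Lemma indeg_ge0 j : 0 <= indeg j.
Proof. by apply: sumr_ge0 => i _; exact: b_ge0. Qed.

Lemma sum_outdeg : \sum_j \sum_k b j k = m.
Proof. by rewrite exchange_big. Qed.

Lemma sum_edge : \sum_j \sum_k edge k j = 2 * m.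
Proof.
transitivity (\sum_j (indeg j + \sum_k b j k)).
  by apply: eq_bigr => j _; rewrite -big_split.
by rewrite big_split /= hm sum_outdeg; ring.
Qed.

Lemma sum_indeg2 : \sum_j indeg j ^+ 2 <= r * m.
Proof.
rewrite -hm mulr_sumr; apply: ler_sum => j _; rewrite expr2.
by apply: ler_wpM2r; [exact: indeg_ge0|exact: hr].
Qed.

(** The orientation enters here: the sum of the squared degrees can be of order m^2, as
    for a star, but one factor that is an in-degree brings it down to r m. *)
Lemma sum_indeg_deg : \sum_j indeg j * (\sum_k edge k j) <= 2 * (r * m).
Proof.
have -> : \sum_j indeg j * (\sum_k edge k j) = \sum_j indeg j ^+ 2 +
  \sum_j indeg j * \sum_k b j k.
  by rewrite -big_split; apply: eq_bigr => j _; rewrite /edge big_split /= -/(indeg j); ring.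
have : \sum_j indeg j * (\sum_k b j k) <= r * m.
  rewrite -sum_outdeg mulr_sumr; apply: ler_sum => j _.
  by apply: ler_wpM2r; [apply: sumr_ge0 => k _; exact: b_ge0|exact: hr].
by have := sum_indeg2; lra.
Qed.

Definition in_sum j x : R := \sum_i b i j * W i j x.

Definition nbr_sum j x : R := \sum_k edge k j * W k j x.

Definition edge_sum x : R := \sum_j in_sum j x.

Lemma resample_in_sum j x : resample j (in_sum j) x = 0.
Proof.
rewrite /in_sum resample_sum big1 // => i _; rewrite resampleZ.
have [->|ij] := eqVneq i j; first by rewrite bii mul0r.
by rewrite resample_cmatchr // mulr0.
Qed.

Lemma resample_nbr_sum j x : resample j (nbr_sum j) x = 0.
Proof.
rewrite /nbr_sum resample_sum big1 // => i _; rewrite resampleZ.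
have [->|ij] := eqVneq i j; first by rewrite edgeii mul0r.
by rewrite resample_cmatchr // mulr0.
Qed.

Lemma in_sum_diff j x u : in_sum j x - in_sum j (recolor x j u) = \sum_i b i j * mdiff R j u i x.
Proof.
rewrite /in_sum -sumrB; apply: eq_bigr => i _; rewrite -mulrBr.
have [->|ij] := eqVneq i j; first by rewrite bii !mul0r.
by rewrite mdiffE.
Qed.

Lemma nbr_sum_diff j x u : nbr_sum j x - nbr_sum j (recolor x j u) =
  \sum_i edge i j * mdiff R j u i x.
Proof.
rewrite /nbr_sum -sumrB; apply: eq_bigr => i _; rewrite -mulrBr.
have [->|ij] := eqVneq i j; first by rewrite edgeii !mul0r.
by rewrite mdiffE.
Qed.

(** Recoloring [j] affects all edges at [j], whereas [in_sum] contains only those that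
    enter [j]. *)
Lemma edge_sum_diff j x u : edge_sum x - edge_sum (recolor x j u) =
  nbr_sum j x - nbr_sum j (recolor x j u).
Proof.
have -> : nbr_sum j x - nbr_sum j (recolor x j u) =
  \sum_i b i j * (W i j x - W i j (recolor x j u)) +
  \sum_k b j k * (W k j x - W k j (recolor x j u)).
  by rewrite /nbr_sum -sumrB -big_split; apply: eq_bigr => k _ /=; rewrite /edge; ring.
rewrite /edge_sum /in_sum -sumrB.
transitivity (\sum_k ((k == j)%:R * \sum_i b i k * (W i k x - W i k (recolor x j u)) +
  b j k * (W k j x - W k j (recolor x j u)))).
  apply: eq_bigr => k _; rewrite -sumrB; have [->|kj] := eqVneq k j.
    rewrite bii mul0r addr0 mul1r; apply: eq_bigr => i _; ring.
  rewrite mul0r add0r (bigD1 j) //= big1 ?addr0 => [|i ij].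
    by rewrite !(cmatchC _ j k); ring.
  by rewrite indep_cmatch // subrr.
by rewrite big_split /= (sum_delta (fun k => \sum_i b i k * (W i k x - W i k (recolor x j u)))).
Qed.

Lemma sum_pair_mean_edge_sum : \sum_j pair_mean j (fun x y => (edge_sum x - edge_sum y) ^+ 2) =
  4 * v * m.
Proof.
transitivity (\sum_j 2 * v * \sum_k edge k j); last first.
  by rewrite -mulr_sumr sum_edge; ring.
apply: eq_bigr => j _.
have mD : mean (fun x => nbr_sum j x ^+ 2) = v * \sum_k edge k j.
  pose g i k := (k == j)%:R * edge i k.
  have e x : nbr_sum j x = \sum_i \sum_k g i k * W i k x.
    apply: eq_bigr => i _; rewrite -[LHS](sum_delta (fun k => edge i k * W i k x) j).
    by apply: eq_bigr => k _; rewrite /g mulrA.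
  rewrite (@eq_mean _ _ _ _ (fun x => (\sum_i \sum_k g i k * W i k x) ^+ 2)); last by move=> x;
    rewrite e.
  rewrite mean_form2_sqr //; last by move=> i; rewrite /g edgeii mulr0.
  congr (_ * _); apply: eq_bigr => i _.
  rewrite -[RHS](sum_delta (fun k => edge i k) j); apply: eq_bigr => k _.
  rewrite /g; have [->|] := eqVneq k j; last by rewrite !mul0r.
  rewrite !mul1r mulrDr edge2; have [->|] := eqVneq i j; last by rewrite mul0r mulr0 addr0.
  by rewrite edgeii; ring.
rewrite (@eq_pair_mean _ _ _ _ _ (fun x y => (nbr_sum j x ^+ 2 + nbr_sum j y ^+ 2) +
  -2 * (nbr_sum j x * nbr_sum j y))); last first.
  by move=> x u; rewrite edge_sum_diff; ring.
rewrite !pair_meanD pair_mean_fst // (pair_mean_snd c0 j (fun y => nbr_sum j y ^+ 2)) pair_meanZ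
  pair_meanMl mD.
rewrite (@eq_mean _ _ _ _ (fun=> 0)); last by move=> x; rewrite resample_nbr_sum mulr0.
by rewrite mean_cst //; ring.
Qed.

Lemma sum_pair_mean_in_edge_sum : \sum_j pair_mean j
  (fun x y => ((in_sum j x - in_sum j y) * (edge_sum x - edge_sum y)) ^+ 2) <=
  2 * v * m + 16 * p * v * (r * m).
Proof.
have v0 := vmatch_ge0 R c0; have pv0 : 0 <= p * v by rewrite mulr_ge0 ?p_ge0.
apply: (@le_trans _ _ (\sum_j (2 * v * indeg j +
  4 * p * v * (indeg j * (\sum_k edge k j) + 2 * indeg j ^+ 2)))).
  apply: ler_sum => j _.
  have key u : mean (fun x => ((in_sum j x - in_sum j (recolor x j u)) *
    (edge_sum x - edge_sum (recolor x j u))) ^+ 2) <=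
     2 * v * indeg j + 4 * p * v * (indeg j * (\sum_k edge k j) + 2 * indeg j ^+ 2).
    rewrite (@eq_mean _ _ _ _ (fun x => ((\sum_i b i j * mdiff R j u i x) *
      (\sum_i edge i j * mdiff R j u i x)) ^+ 2)); last first.
      by move=> x; rewrite edge_sum_diff in_sum_diff nbr_sum_diff.
    apply: le_trans (mean_mdiff_forms_le c0 u (fun i => b_ge0 i j) (fun i => edge_ge0 i j)
      (bii j) (edgeii j)) _.
    rewrite le_eqVlt; apply/orP; left; apply/eqP.
    have e1 : \sum_i b i j ^+ 2 * edge i j ^+ 2 = indeg j.
      by apply: eq_bigr => i _; rewrite !expr2 hb2 edge2 b_edge.
    have e2 : \sum_i b i j ^+ 2 = indeg j by apply: eq_bigr => i _; rewrite expr2 hb2.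
    have e3 : \sum_i edge i j ^+ 2 = \sum_i edge i j by apply: eq_bigr => i _;
      rewrite expr2 edge2.
    have e4 : \sum_i b i j * edge i j = indeg j by apply: eq_bigr => i _; rewrite b_edge.
    by rewrite e1 e2 e3 e4.
  rewrite /pair_mean meanZ mean_sum ler_pdivrMl ?ltr0n //.
  apply: le_trans (ler_sum _ (fun u _ => key u)) _.
  by rewrite sumr_const card_ord -[_ *+ c]mulr_natl.
rewrite big_split /= -!mulr_sumr hm big_split /= -mulr_sumr.
have h1 := sum_indeg2; have h2 := sum_indeg_deg.
have := ler_wpM2l pv0 h1; have := ler_wpM2l pv0 h2.
lra.
Qed.

Definition cherry i k j : R := b i j * edge j k * (i != k)%:R.

Definition n_cherry i k : R := \sum_j cherry i k j.

(** Collects the single edges and the averages over [j] of the paths i - j - k. *)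
Definition coef2 i k : R := (1 - 2 * c%:R^-1) * b i k + 2 * c%:R^-1 * n_cherry i k.

(** In the product of [in_sum] and [nbr_sum], the terms with i = k are squares and give
    the constant and the edges by [cmatch_sqr]; the others are split by [degen3]. *)
Lemma carre_du_champ_expand x :
  \sum_j (c%:R^-1 * \sum_u (in_sum j x - in_sum j (recolor x j u)) *
    (edge_sum x - edge_sum (recolor x j u))) =
  2 * v * m + (\sum_i \sum_k coef2 i k * W i k x +
    \sum_i \sum_k \sum_j cherry i k j * degen3 R i k j x).
Proof.
have e1 j : c%:R^-1 * \sum_u (in_sum j x - in_sum j (recolor x j u)) *
  (edge_sum x - edge_sum (recolor x j u)) =
  \sum_i \sum_k b i j * edge j k * (W i j x * W j k x + c%:R^-1 * W i k x).
  transitivity (resample j (fun y => in_sum j x * nbr_sum j x +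
    (in_sum j y * nbr_sum j y + (- nbr_sum j x * in_sum j y + - in_sum j x * nbr_sum j y))) x).
    by congr (_ * _); apply: eq_bigr => u _; rewrite edge_sum_diff; ring.
  rewrite !resampleD !resampleZ resample_in_sum resample_nbr_sum !mulr0 !addr0.
  rewrite (resample_indep c0 _ (indep_cst _ _)).
  have UD y : in_sum j y * nbr_sum j y = \sum_i \sum_k b i j * edge j k * (W i j y * W j k y).
    rewrite /in_sum /nbr_sum big_distrlr /=; apply: eq_bigr => i _; apply: eq_bigr => k _.
    by rewrite (edgeC k) (cmatchC _ k); ring.
  rewrite (@eq_resample _ _ _ _ _ (fun y => \sum_i \sum_k b i j * edge j k *
    (W i j y * W j k y))) //.
  rewrite UD resample_sum -big_split /=; apply: eq_bigr => i _.
  rewrite resample_sum -big_split /=; apply: eq_bigr => k _; rewrite resampleZ -mulrDr.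
  have [->|ij] := eqVneq i j; first by rewrite bii !mul0r.
  have [->|kj] := eqVneq k j; first by rewrite edgeii mulr0 !mul0r.
  by rewrite resample_cherry.
rewrite (eq_bigr _ (fun j _ => e1 j)).
transitivity (\sum_j \sum_i \sum_k ((k == i)%:R *
  (b i j * ((1 - 2 * c%:R^-1) * W i j x + 2 * v)) +
  cherry i k j * (degen3 R i k j x + 2 * c%:R^-1 * W i k x))).
  apply: eq_bigr => j _; apply: eq_bigr => i _; apply: eq_bigr => k _.
  rewrite /cherry (eq_sym i k); have [->|ki] := eqVneq k i.
    rewrite (edgeC j i) b_edge (cmatchC _ j i) cmatchxx -expr2 cmatch_sqr /vmatch /=; ring.
  rewrite /degen3 /=; ring.
transitivity (\sum_j (\sum_i b i j * ((1 - 2 * c%:R^-1) * W i j x + 2 * v)) +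
  \sum_j \sum_i \sum_k cherry i k j * (degen3 R i k j x + 2 * c%:R^-1 * W i k x)).
  rewrite -big_split; apply: eq_bigr => j _; rewrite -big_split; apply: eq_bigr => i _ /=.
  by rewrite big_split /= (sum_delta (fun k => b i j * ((1 - 2 * c%:R^-1) * W i j x + 2 * v))).
have -> : \sum_j \sum_i b i j * ((1 - 2 * c%:R^-1) * W i j x + 2 * v) =
   2 * v * m + \sum_i \sum_k (1 - 2 * c%:R^-1) * b i k * W i k x.
  rewrite [X in _ = _ + X]exchange_big -hm mulr_sumr -big_split; apply: eq_bigr => j _ /=.
  rewrite mulr_sumr -big_split; apply: eq_bigr => i _ /=; ring.
have -> : \sum_j \sum_i \sum_k cherry i k j * (degen3 R i k j x + 2 * c%:R^-1 * W i k x) =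
  \sum_i \sum_k \sum_j cherry i k j * degen3 R i k j x +
    \sum_i \sum_k 2 * c%:R^-1 * n_cherry i k * W i k x.
  rewrite exchange_big -big_split; apply: eq_bigr => i _ /=.
  rewrite exchange_big -big_split; apply: eq_bigr => k _ /=.
  rewrite /n_cherry mulr_sumr mulr_suml -big_split; apply: eq_bigr => j _ /=; ring.
rewrite -addrA; congr (_ + _); rewrite addrCA [RHS]addrC; congr (_ + _).
rewrite -big_split; apply: eq_bigr => i _; rewrite -big_split; apply: eq_bigr => k _ /=.
rewrite /coef2; ring.
Qed.

Lemma cherry_ge0 i k j : 0 <= cherry i k j.
Proof. by rewrite /cherry !mulr_ge0 ?b_ge0 ?edge_ge0. Qed.

Lemma cherry_le i k j : cherry i k j <= b i j * edge j k.
Proof. by rewrite /cherry ler_piMr ?mulr_ge0 ?b_ge0 ?edge_ge0 // lern1 leq_b1. Qed.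

Lemma cherry_le1 i k j : cherry i k j <= 1.
Proof.
apply: le_trans (cherry_le _ _ _) _.
by rewrite mulr_ile1 ?b_ge0 ?edge_ge0 ?b_le1 ?edge_le1.
Qed.

Lemma sum_cherry : \sum_i \sum_k \sum_j cherry i k j <= 2 * (r * m).
Proof.
apply: le_trans sum_indeg_deg.
apply: (@le_trans _ _ (\sum_i \sum_k \sum_j b i j * edge j k)).
  by do 3 (apply: ler_sum => ? _); exact: cherry_le.
rewrite le_eqVlt; apply/orP; left; apply/eqP.
transitivity (\sum_i \sum_j \sum_k b i j * edge j k).
  by apply: eq_bigr => i _; rewrite exchange_big.
rewrite exchange_big; apply: eq_bigr => j _ /=.
rewrite /indeg mulr_suml; apply: eq_bigr => i _; rewrite mulr_sumr.
by apply: eq_bigr => k _; rewrite (edgeC k).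
Qed.

Definition C4_hom : R := \sum_i \sum_j \sum_k \sum_(l | uniq [:: i; j; k; l]) edge i j * edge j
  k * edge k l * edge l i.

(** Two different middle vertices between [i] and [k] make a 4-cycle; twice the same one
    is counted by [sum_cherry]. *)
Lemma sum_n_cherry_sqr : \sum_i \sum_k (n_cherry i k + n_cherry k i) ^+ 2 <= 4 * C4_hom +
  8 * (r * m).
Proof.
pose ka i k j := cherry i k j + cherry k i j.
have ka0 i k j : 0 <= ka i k j by rewrite addr_ge0 ?cherry_ge0.
have ka2 i k j : ka i k j <= 2 by have := cherry_le1 i k j; have := cherry_le1 k i j;
  rewrite /ka; lra.
have kaa i k j : ka i k j <= 2 * (edge i j * edge j k * (i != k)%:R).
  have h1 : cherry i k j <= edge i j * edge j k * (i != k)%:R.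
    by apply: ler_wpM2r => //; apply: ler_wpM2r; rewrite ?edge_ge0 ?b_le_edge.
  have h2 : cherry k i j <= edge i j * edge j k * (i != k)%:R.
    rewrite /cherry (eq_sym k i) (mulrC (b k j)) (edgeC j i); apply: ler_wpM2r => //.
    by apply: ler_wpM2l; rewrite ?edge_ge0 // (edgeC j k) b_le_edge.
  by rewrite /ka; lra.
apply: (@le_trans _ _ (\sum_i \sum_k (\sum_j ka i k j ^+ 2 +
  \sum_j \sum_(l | l != j) ka i k j * ka i k l))).
  apply: ler_sum => i _; apply: ler_sum => k _.
  rewrite /n_cherry -big_split /= expr2 big_distrlr -big_split; apply: ler_sum => j _ /=.
  by rewrite (bigD1 j) //= expr2.
have -> : \sum_i \sum_k (\sum_j ka i k j ^+ 2 + \sum_j \sum_(l | l != j) ka i k j * ka i k l) =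
  \sum_i \sum_k \sum_j ka i k j ^+ 2 + \sum_i \sum_k \sum_j \sum_(l | l != j) ka i k j * ka i k l.
  by rewrite -big_split; apply: eq_bigr => i _; rewrite -big_split.
rewrite addrC; apply: lerD.
  apply: (@le_trans _ _ (\sum_i \sum_k \sum_j \sum_(l | uniq [:: i; j; k; l]) 4 *
    (edge i j * edge j k * edge k l * edge l i))).
    apply: ler_sum => i _; apply: ler_sum => k _; apply: ler_sum => j _.
    rewrite big_mkcond [X in _ <= X]big_mkcond; apply: ler_sum => l _ /=.
    have [lj|lj] /= := boolP (l != j); last first.
      by case: ifP => // _; rewrite !mulr_ge0 ?edge_ge0.
    apply: (@le_trans _ _ (2 * (edge i j * edge j k * (i != k)%:R) *
      (2 * (edge i l * edge l k * (i != k)%:R)))).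
      by apply: ler_pM.
    rewrite !inE !negb_or andbT (edgeC l i) (edgeC k l).
    have [->|ij] /= := eqVneq i j; first by rewrite edgeii; lra.
    have [->|ik] /= := eqVneq i k; first by lra.
    have [->|il] /= := eqVneq i l; first by rewrite edgeii; lra.
    have [->|jk] /= := eqVneq j k; first by rewrite edgeii; lra.
    have [->|kl] /= := eqVneq k l; first by rewrite edgeii ?andbF; lra.
    by rewrite (eq_sym j) lj /=; lra.
  rewrite le_eqVlt; apply/orP; left; apply/eqP.
  rewrite /C4_hom mulr_sumr; apply: eq_bigr => i _; rewrite exchange_big mulr_sumr;
    apply: eq_bigr => j _.
  rewrite mulr_sumr; apply: eq_bigr => k _; by rewrite mulr_sumr.
apply: (@le_trans _ _ (\sum_i \sum_k \sum_j 2 * ka i k j)).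
  by do 3 (apply: ler_sum => ? _); rewrite expr2 ler_wpM2r.
have -> : \sum_i \sum_k \sum_j 2 * ka i k j = 2 * (\sum_i \sum_k \sum_j cherry i k j) +
  2 * (\sum_i \sum_k \sum_j cherry k i j).
  rewrite !mulr_sumr -big_split; apply: eq_bigr => i _ /=; rewrite !mulr_sumr -big_split;
    apply: eq_bigr => k _ /=.
  rewrite !mulr_sumr -big_split; apply: eq_bigr => j _ /=; rewrite /ka; ring.
have -> : \sum_i \sum_k \sum_j cherry k i j =
  \sum_i \sum_k \sum_j cherry i k j by rewrite exchange_big.
have := sum_cherry; lra.
Qed.

(** The two forms are orthogonal, since a vertex of a triple is always missing from a
    pair. The first is split as (X + Y)^2 <= 7 X^2 + 7/6 Y^2, with Y the paths: the weights
    keep the factor of the 4-cycles small, which has the least room in [num_variance]. *)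
Lemma mean_carre_parts : mean (fun x => (\sum_i \sum_k coef2 i k * W i k x +
  \sum_i \sum_k \sum_j cherry i k j * degen3 R i k j x) ^+ 2) <=
  v / 2 * (14 * (1 - 2 * c%:R^-1) ^+ 2 * m + 14 / 3 * c%:R^-1 ^+ 2 * (4 * C4_hom + 8 * (r * m)))
    + 12 * v ^+ 2 * (r * m).
Proof.
have v0 := vmatch_ge0 R c0.
have be01 i k j : 0 <= cherry i k j <= 1 by rewrite cherry_ge0 cherry_le1.
have beN i k j : ~~ [&& i != k, i != j & k != j] -> cherry i k j = 0.
  rewrite /cherry; have [->|ik] /= := eqVneq i k; first by rewrite mulr0.
  have [->|ij] /= := eqVneq i j; first by rewrite bii !mul0r.
  by have [->|kj] //= := eqVneq k j; rewrite edgeii mulr0 mul0r.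
have gii i : coef2 i i = 0.
  rewrite /coef2 bii mulr0 add0r /n_cherry big1 ?mulr0 // => j _;
    rewrite /cherry eqxx /= mulr0 //.
set L := fun x => \sum_i \sum_k coef2 i k * W i k x.
set Ht := fun x => \sum_i \sum_k \sum_j cherry i k j * degen3 R i k j x.
have cross : mean (fun x => L x * Ht x) = 0.
  rewrite (@eq_mean _ _ _ _ (fun x => \sum_l \sum_l' \sum_i \sum_k \sum_j
    (coef2 l l' * cherry i k j) * (W l l' x * degen3 R i k j x))).
    do 5 (rewrite mean_sum; apply: big1 => ? _).
    match goal with |- mean (fun x => coef2 ?l ?l' * cherry ?i ?k ?j * _) = _ =>
      rewrite meanZ; have [->|ll'] := eqVneq l l'; first (by rewrite gii !mul0r);
      have [/and3P[ik ij kj]|nd] := boolP [&& i != k, i != j & k != j];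
        last (by rewrite beN // mulr0 mul0r);
      by rewrite mean_degen3_cmatch // mulr0 end.
  move=> x; rewrite /L /Ht mulr_suml; apply: eq_bigr => l _; rewrite mulr_suml;
    apply: eq_bigr => l' _.
  do 3 (rewrite mulr_sumr; apply: eq_bigr => ? _); ring.
rewrite (@eq_mean _ _ _ _ (fun x => L x ^+ 2 + (Ht x ^+ 2 + 2 * (L x * Ht x))));
  last by move=> x; rewrite -/(L x) -/(Ht x); ring.
rewrite !meanD meanZ cross mulr0 addr0; apply: lerD; last first.
  apply: le_trans (mean_form3_sqr_le c0 be01 beN) _.
  have v2 : 0 <= v ^+ 2 by exact: sqr_ge0.
  have := ler_wpM2l v2 sum_cherry; lra.
rewrite mean_form2_sqr //.
have E1 : \sum_i \sum_k coef2 i k * (coef2 i k + coef2 k i) =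
  2^-1 * \sum_i \sum_k (coef2 i k + coef2 k i) ^+ 2.
  have e : \sum_i \sum_k coef2 i k * (coef2 i k + coef2 k i) =
    \sum_i \sum_k coef2 k i * (coef2 i k + coef2 k i).
    rewrite exchange_big; apply: eq_bigr => i _; apply: eq_bigr => k _; ring.
  have -> : \sum_i \sum_k (coef2 i k + coef2 k i) ^+ 2 =
    \sum_i \sum_k coef2 i k * (coef2 i k + coef2 k i) +
    \sum_i \sum_k coef2 k i * (coef2 i k + coef2 k i).
    by rewrite -big_split; apply: eq_bigr => i _; rewrite -big_split; apply: eq_bigr => k _ /=;
      ring.
  by rewrite -e; field.
rewrite E1 [X in X <= _]mulrA; apply: ler_wpM2l; first by rewrite divr_ge0.
have p2 : 0 <= c%:R^-1 ^+ 2 :> R by exact: sqr_ge0.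
apply: (@le_trans _ _ (7 * (1 - 2 * c%:R^-1) ^+ 2 * (\sum_k \sum_i edge i k) +
  14 / 3 * c%:R^-1 ^+ 2 * (\sum_i \sum_k (n_cherry i k + n_cherry k i) ^+ 2))); last first.
  rewrite sum_edge; have := ler_wpM2l p2 sum_n_cherry_sqr; lra.
rewrite exchange_big !mulr_sumr -big_split; apply: ler_sum => i _ /=.
rewrite !mulr_sumr -big_split; apply: ler_sum => k _ /=.
rewrite -edge2 /coef2 /edge.
have := sqr_ge0 (6 * ((1 - 2 * c%:R^-1) * (b i k + b k i)) - 2 * c%:R^-1 *
  (n_cherry i k + n_cherry k i)).
move: (1 - 2 * c%:R^-1 : R) (c%:R^-1 : R) (b i k) (b k i) (n_cherry i k) (n_cherry k i) =>
  q1 q2 q3 q4 q5 q6.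
rewrite !expr2; lra.
Qed.
End oriented_graph.

(** * Orienting edges by decreasing degree *)

Section orientation.
Variables (R : realType) (n : nat) (E : {set {set 'I_n}}).
Hypothesis hE : simple_edges E.
Implicit Types (i j k : 'I_n).

Definition deg i : nat := (\sum_j ([set i; j]%SET \in E))%N.

Definition prec i j := (deg j < deg i)%N || ((deg j == deg i) && (i < j)%N).

Definition orient i j : R := (([set i; j]%SET \in E) && prec i j)%:R.

Lemma adjC i j : adj R E i j = adj R E j i.
Proof. by rewrite /adj finset.setUC. Qed.

Lemma edge_ii i : ([set i; i]%SET \in E) = false.
Proof. by apply/negP => /hE; rewrite cards2 eqxx. Qed.

Lemma precN i j : prec i j -> prec j i = false.
Proof.
rewrite /prec => /orP[h|/andP[/eqP -> h]].
  by rewrite ltnNge (ltnW h) /= (gtn_eqF h).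
by rewrite ltnn eqxx /= ltnNge (ltnW h).
Qed.

Lemma prec_total i j : i != j -> prec i j || prec j i.
Proof.
rewrite /prec => ij; have [//|h|h] := ltngtP (deg j) (deg i); rewrite ?orbT //=.
by case: (ltngtP i j) ij => // /val_inj ->; rewrite eqxx.
Qed.

Lemma orient2 i j : orient i j * orient i j = orient i j.
Proof. by rewrite /orient; case: (_ && _); rewrite ?mulr1 ?mulr0. Qed.

Lemma orientM i j : orient i j * orient j i = 0.
Proof.
rewrite /orient; have [/precN ->|_] := boolP (prec i j); first by rewrite andbF mulr0.
by rewrite andbF mul0r.
Qed.

Lemma edge_orient i j : edge orient i j = adj R E i j.
Proof.
rewrite /edge /orient /adj (finset.setUC [set j]%SET); have [->|ij] := eqVneq i j.
  by rewrite edge_ii /= addr0.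
case: (_ \in E) => /=; last by rewrite addr0.
have := prec_total ij; have [/precN ->|_ /= ->] := boolP (prec i j); rewrite ?addr0 ?add0r //.
Qed.

Lemma sum_adj : \sum_j \sum_i adj R E i j = 2 * #|E|%:R.
Proof.
rewrite /adj pair_big /=.
transitivity (\sum_(z : 'I_n * 'I_n) \sum_(e in E) ([set z.2; z.1]%SET == e)%:R : R).
  apply: eq_bigr => z _; have [zE|zE] := boolP (_ \in E).
    rewrite (bigD1 [set z.2; z.1]%SET) //= eqxx big1 ?addr0 // => e /andP[_].
    by rewrite eq_sym => /negbTE ->.
  rewrite big1 // => e eE; have [ee|//] := eqVneq [set z.2; z.1]%SET e.
  by rewrite ee eE in zE.
rewrite exchange_big /= mulr_natr -sumr_const; apply: eq_bigr => e /hE ce.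
have /cards2P[s [t [st ->]]] : #|e| == 2%N by rewrite ce.
rewrite (bigD1 (s, t)) //= (bigD1 (t, s)) /=; last first.
  by rewrite xpair_eqE negb_and eq_sym st.
rewrite big1 ?addr0.
  by rewrite (finset.setUC [set t]%SET) eqxx.
move=> [z1 z2] /=; rewrite !xpair_eqE => /andP[h1 h2].
have [ez|//] := eqVneq; exfalso.
have : z1 \in [set s; t]%SET by rewrite -ez !inE eqxx orbT.
have : z2 \in [set s; t]%SET by rewrite -ez !inE eqxx.
have : s \in [set z2; z1]%SET by rewrite ez !inE eqxx.
have : t \in [set z2; z1]%SET by rewrite ez !inE eqxx orbT.
rewrite !inE => /orP[]/eqP ? /orP[]/eqP ? ; subst;
  rewrite ?eqxx ?andbT ?andbF ?(negbTE st) /= in h1 h2 st *; by rewrite ?orbT ?orbF //.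
Qed.

Lemma sum_orient : \sum_j \sum_i orient i j = #|E|%:R.
Proof.
have h : \sum_j \sum_k edge orient k j = 2 * #|E|%:R.
  by rewrite -sum_adj; apply: eq_bigr => j _; apply: eq_bigr => i _; exact: edge_orient.
have := sum_edge (erefl (\sum_j \sum_i orient i j)); rewrite h; lra.
Qed.

(** Each in-neighbor of [j] has degree at least [deg j], hence at least the in-degree of
    [j], so the square of the in-degree is at most the sum of all degrees. *)
Lemma indeg_orient j : indeg orient j <= Num.sqrt (2 * #|E|%:R).
Proof.
pose d k : R := (deg k)%:R.
have d_adj k : d k = \sum_i adj R E i k.
  by rewrite /d /deg natr_sum; apply: eq_bigr => i _; rewrite adjC.
have i0 : 0 <= indeg orient j by apply: sumr_ge0 => i _; rewrite /orient.
have id : indeg orient j <= d j.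
  rewrite d_adj; apply: ler_sum => i _; rewrite /orient /adj.
  by case: (_ \in E) => /=; rewrite ?ler_nat ?leq_b1.
rewrite -[leLHS]ger0_norm // -sqrtr_sqr ler_wsqrtr // expr2.
rewrite -sum_adj {1}/indeg mulr_suml; apply: ler_sum => i _.
rewrite -(d_adj i) /orient.
case: (_ \in E) => /=; last by rewrite mul0r.
have [h|] := boolP (prec i j); last by rewrite mul0r.
rewrite mul1r; apply: le_trans id _; rewrite ler_nat.
by case/orP: h => [/ltnW //|/andP[/eqP -> _]].
Qed.

Lemma C4_hom_orient : C4_hom orient = 8 * C4_copies R E.
Proof.
rewrite /C4_hom /C4_copies mulrA divff // mul1r.
by do 4 (apply: eq_bigr => ? _); rewrite !edge_orient.
Qed.

Lemma half_sum (s : 'I_n -> 'I_n -> R) : (forall i j, s i j = s j i) -> (forall i, s i i = 0) ->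
  2 * (\sum_(i < n) \sum_(j < n | (i < j)%N) s i j) = \sum_i \sum_j s i j.
Proof.
move=> sC s0.
have e : \sum_(i < n) \sum_(j < n | (i < j)%N) s i j =
  \sum_(i < n) \sum_(j < n | (j < i)%N) s i j.
  under eq_bigr => i _ do rewrite big_mkcond /=.
  rewrite exchange_big; apply: eq_bigr => i _ /=; rewrite [RHS]big_mkcond.
  by apply: eq_bigr => j _; rewrite sC.
rewrite mulr_natl mulr2n [X in _ + X]e -big_split; apply: eq_bigr => i _ /=.
rewrite [X in X + _]big_mkcond [X in _ + X]big_mkcond -big_split; apply: eq_bigr => j _ /=.
case: ltngtP => [h|h|/val_inj ->]; rewrite ?addr0 ?add0r //.
Qed.

Lemma orient_sum (w : 'I_n -> 'I_n -> R) : (forall i j, w i j = w j i) ->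
  \sum_(i < n) \sum_(j < n | (i < j)%N) adj R E i j * w i j = \sum_j \sum_i orient i j * w i j.
Proof.
move=> wC.
have h1 := @half_sum (fun i j => adj R E i j * w i j).
have h2 : \sum_i \sum_j adj R E i j * w i j = 2 * \sum_j \sum_i orient i j * w i j.
  rewrite mulr_natl mulr2n [X in _ = X + _]exchange_big -big_split; apply: eq_bigr => i _ /=.
  rewrite -big_split; apply: eq_bigr => j _ /=.
  by rewrite -edge_orient /edge (wC j i); ring.
have h : 2 * (\sum_(i < n) \sum_(j < n | (i < j)%N) adj R E i j * w i j) =
  \sum_i \sum_j adj R E i j * w i j.
  by apply: h1 => [i j|i]; [rewrite adjC wC|rewrite /adj edge_ii mul0r].
by rewrite h2 in h; lra.
Qed.
End orientation.

(** * The normal approximation *)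

Section constants.
Variable R : realType.

(** Here [C] is the number of colors, [q] and [w] are the square roots of [m] and 2, and
    25/16 is the square of the constant in [stein_solution]. *)
Lemma num_variance (C m q w N : R) : 2 <= C -> 1 <= m -> 1 <= q -> q ^+ 2 = m -> 1 <= w -> 0 <=
  N ->
  forall v r, v = C^-1 * (1 - C^-1) -> r = w * q ->
  25 / 16 * ((2 * v * m) ^- 2 * (v / 2 * (14 * (1 - 2 * C^-1) ^+ 2 * m + 14 / 3 * C^-1 ^+
    2 * (4 * (8 * N) + 8 * (r * m))) + 12 * v ^+ 2 * (r * m)))
  <= 3 * (C - 2) / m + 10 * w / q + 15 * w / (q * (C - 1)) + 30 * N / (m ^+ 2 * (C - 1)).
Proof.
move=> hC hm hq qm hw hN v r vE rE.
have C0 : 0 < C by lra.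
have C1 : 0 < C - 1 by lra.
have m0 : 0 < m by lra.
have q0 : 0 < q by lra.
have -> : (2 * v * m) ^- 2 * (v / 2 * (14 * (1 - 2 * C^-1) ^+ 2 * m + 14 / 3 * C^-1 ^+
  2 * (4 * (8 * N) + 8 * (r * m))) + 12 * v ^+ 2 * (r * m)) =
  7 / 4 * ((C - 2) ^+ 2 / (m * (C - 1))) + 56 / 3 * (N / (m ^+ 2 * (C - 1))) +
    14 / 3 * (w / (q * (C - 1))) + 3 * (w / q).
  by rewrite vE rE -qm; field; rewrite !gt_eqF //; lra.
have h1 : (C - 2) ^+ 2 / (m * (C - 1)) <= (C - 2) / m.
  rewrite expr2 invfM mulrACA -[X in _ <= X]mulr1; apply: ler_wpM2l.
    by rewrite divr_ge0 ?(ltW m0) //; lra.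
  by rewrite ler_pdivrMr //; lra.
have h2 : 0 <= N / (m ^+ 2 * (C - 1)) by rewrite divr_ge0 ?mulr_ge0 ?exprn_ge0 ?(ltW m0)
  ?(ltW C1).
have h3 : 0 <= w / (q * (C - 1)) by rewrite divr_ge0 ?mulr_ge0 ?(ltW q0) ?(ltW C1) //; lra.
have h4 : 0 <= w / q by rewrite divr_ge0 ?(ltW q0) //; lra.
have h5 : 0 <= (C - 2) / m by rewrite divr_ge0 ?(ltW m0) //; lra.
rewrite -!mulrA.
lra.
Qed.

Lemma num_remainder (C m q w : R) : 2 <= C -> 1 <= m -> 1 <= q -> q ^+ 2 = m -> 1 <= w ->
  forall v r, v = C^-1 * (1 - C^-1) -> r = w * q ->
  4^-1 * ((v * m) ^- 2 * (2 * v * m + 16 * C^-1 * v * (r * m))) <=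
  2 * ((C - 1) / m + 5 * w / (q * (C - 1)) + 7 * w / q).
Proof.
move=> hC hm hq qm hw v r vE rE.
have C0 : 0 < C by lra.
have C1 : 0 < C - 1 by lra.
have m0 : 0 < m by lra.
have q0 : 0 < q by lra.
have -> : 4^-1 * ((v * m) ^- 2 * (2 * v * m + 16 * C^-1 * v * (r * m))) =
  2^-1 * ((C - 1) / m) + m^-1 + 2^-1 * (m^-1 / (C - 1)) + 4 * (w / q) + 4 * (w / (q * (C - 1))).
  by rewrite vE rE -qm; field; rewrite !gt_eqF //; lra.
have h1 : m^-1 <= w / q.
  rewrite -qm expr2 invfM; apply: ler_wpM2r; first by rewrite invr_ge0 ltW.
  by apply: le_trans hw; rewrite invf_le1.
have h2 : m^-1 / (C - 1) <= w / (q * (C - 1)).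
  by rewrite invfM mulrA; apply: ler_wpM2r => //; rewrite invr_ge0 ltW.
have h3 : 0 <= w / (q * (C - 1)) by rewrite divr_ge0 ?mulr_ge0 ?(ltW q0) ?(ltW C1) //; lra.
have h4 : 0 <= w / q by rewrite divr_ge0 ?(ltW q0) //; lra.
have h5 : 0 <= (C - 1) / m by rewrite divr_ge0 ?(ltW m0) ?(ltW C1).
rewrite -!mulrA.
lra.
Qed.
End constants.

Section uniform_bound.
Variables (R : realType) (n c : nat) (E : {set {set 'I_n}}).
Hypothesis hE : simple_edges E.
Hypothesis c2 : (2 <= c)%N.
Let c0 : (0 < c)%N. Proof. exact: leq_trans c2. Qed.
Notation Om := {ffun 'I_n -> 'I_c}.
Local Notation v := (vmatch R c).
Notation b := (orient R E).
Notation m := (#|E|%:R : R).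

Lemma vmatch_gt0 : 0 < v.
Proof.
rewrite /vmatch mulr_gt0 ?invr_gt0 ?ltr0n // subr_gt0 invf_lt1 ?ltr1n ?ltr0n //.
Qed.

Lemma monochromatic_edge_sum (x : Om) :
  monochromatic_edges R E (fun i (_ : unit) => (x i).+1) tt = edge_sum b x + m * c%:R^-1.
Proof.
rewrite /monochromatic_edges /edge_sum /in_sum -orient_sum //; last by move=> i j;
  rewrite cmatchC.
rewrite -(sum_orient R hE) mulr_suml.
under [X in _ = _ + X]eq_bigr => j _ do rewrite mulr_suml.
rewrite -[X in _ = _ + X](@orient_sum _ _ _ hE (fun _ _ => c%:R^-1)) //.
rewrite -big_split; apply: eq_bigr => i _ /=; rewrite -big_split; apply: eq_bigr => j _ /=.
by rewrite /cmatch eqSS -val_eqE; ring.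
Qed.

Lemma mean_edge_sum : mean (fun x : Om => edge_sum b x) = 0.
Proof.
rewrite /edge_sum /in_sum mean_sum big1 // => j _; rewrite mean_sum big1 // => i _; rewrite meanZ.
have [->|ij] := eqVneq i j; first by rewrite (bii (orient2 R E) (orientM R E)) mul0r.
by rewrite mean_cmatch // mulr0.
Qed.

Lemma mean_edge_sum_sqr : mean (fun x : Om => edge_sum b x ^+ 2) = v * m.
Proof.
rewrite (@eq_mean _ _ _ _ (fun x => (\sum_i \sum_k b i k * cmatch R i k x) ^+ 2)); last first.
  by move=> x; rewrite /edge_sum /in_sum exchange_big.
rewrite mean_form2_sqr //; last by move=> i; rewrite (bii (orient2 R E) (orientM R E)).
congr (_ * _); rewrite -(sum_orient R hE) exchange_big; apply: eq_bigr => i _;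
  apply: eq_bigr => k _ /=.
by rewrite mulrDr orient2 orientM addr0.
Qed.

Hypothesis E1 : (1 <= #|E|)%N.

Lemma discrete_bound (f f' : R -> R) :
  (forall x : R, is_derive x 1 f (f' x)) ->
  (forall x, `|f' x| <= 5 / 4 * Num.sqrt (2 / pi)) ->
  (forall x y, `|f' x - f' y| <= 2 * `|x - y|) ->
  forall s, s = Num.sqrt (v * m) ->
  `|mean (fun x : Om => f' (s^-1 * edge_sum b x) - s^-1 * edge_sum b x * f
    (s^-1 * edge_sum b x))| <=
   Num.sqrt (2 / pi) *
      Num.sqrt (3 * (c%:R - 2) / m
                + 10 * Num.sqrt 2 / Num.sqrt m
                + 15 * Num.sqrt 2 / (Num.sqrt m * (c%:R - 1))
                + 30 * C4_copies R E / (m ^+ 2 * (c%:R - 1)))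
    + Num.sqrt 2 *
      Num.sqrt ((c%:R - 1) / m
                + 5 * Num.sqrt 2 / (Num.sqrt m * (c%:R - 1))
                + 7 * Num.sqrt 2 / Num.sqrt m).
Proof.
move=> Df bf' lf' s sE.
have m1 : 1 <= m by rewrite ler1n.
have m0 : 0 < m by lra.
have v0 := vmatch_gt0.
have s2 : s ^+ 2 = v * m by rewrite sE sqr_sqrtr // ltW // mulr_gt0.
have s0 : 0 < s by rewrite sE sqrtr_gt0 mulr_gt0.
have sn0 : s != 0 by rewrite gt_eqF.
pose q := Num.sqrt m; pose w := Num.sqrt 2 : R.
have q2 : q ^+ 2 = m by rewrite sqr_sqrtr // ltW.
have q1 : 1 <= q by rewrite -[X in X <= _]sqrtr1 ler_wsqrtr.
have w1 : 1 <= w by rewrite -[X in X <= _]sqrtr1 ler_wsqrtr // ler1n.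
have rE : Num.sqrt (2 * m) = w * q by rewrite sqrtrM.
have C2 : 2 <= c%:R :> R by rewrite ler_nat.
have N0 : 0 <= C4_copies R E.
  rewrite /C4_copies mulr_ge0 ?invr_ge0 //.
  by do 4 (apply: sumr_ge0 => ? _); rewrite /adj !mulr_ge0.
have hb2 := orient2 R E; have hbb := orientM R E; have hsum := sum_orient R hE.
have hr := indeg_orient R hE; rewrite rE in hr.
have resU j (x : Om) : resample j (fun x => s^-1 * in_sum b j x) x = 0.
  by rewrite resampleZ (resample_in_sum c0 hb2 hbb) mulr0.
have FU (x : Om) : s^-1 * edge_sum b x = \sum_j s^-1 * in_sum b j x by rewrite mulr_sumr.
have := stein_pair_bound c0 resU Df bf' lf' FU.
have -> : \sum_j pair_mean j (fun x y : Om => (s^-1 * edge_sum b x - s^-1 * edge_sum b y) ^+ 2)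
  = 4.
  have H := sum_pair_mean_edge_sum c0 hb2 hbb hsum.
  transitivity (s ^- 2 * (4 * v * m)); last by rewrite s2; field; rewrite !gt_eqF.
  rewrite -H mulr_sumr; apply: eq_bigr => j _; rewrite -pair_meanZ; apply: eq_pair_mean => x u.
  by rewrite -mulrBr exprMn exprVn.
have -> : Num.sqrt 4 = 2 :> R.
  by have -> : 4 = 2 ^+ 2 :> R by [ring]; rewrite sqrtr_sqr ger0_norm.
have HM : 4^-1 * (\sum_j pair_mean j (fun x y :
  Om => ((s^-1 * in_sum b j x - s^-1 * in_sum b j y) *
  (s^-1 * edge_sum b x - s^-1 * edge_sum b y)) ^+ 2)) <=
   2 * ((c%:R - 1) / m + 5 * w / (q * (c%:R - 1)) + 7 * w / q).
  apply: le_trans (num_remainder C2 m1 q1 q2 w1 erefl erefl).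
  apply: ler_wpM2l; first by rewrite invr_ge0.
  have -> : \sum_j pair_mean j (fun x y : Om =>
    ((s^-1 * in_sum b j x - s^-1 * in_sum b j y) * (s^-1 * edge_sum b x - s^-1 * edge_sum b y))
    ^+ 2) =
    (v * m) ^- 2 * \sum_j pair_mean j (fun x y :
      Om => ((in_sum b j x - in_sum b j y) * (edge_sum b x - edge_sum b y)) ^+ 2).
    rewrite mulr_sumr; apply: eq_bigr => j _; rewrite -pair_meanZ; apply: eq_pair_mean => x u.
    by rewrite -s2; field.
  apply: ler_wpM2l; first by rewrite invr_ge0 sqr_ge0.
  exact: (sum_pair_mean_in_edge_sum c0 hb2 hbb hsum hr).
have HV : 25 / 16 * mean (fun x : Om => (1 - carre_du_champ (fun j x => s^-1 * in_sum b j x)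
  (fun x => s^-1 * edge_sum b x) x) ^+ 2) <=
   3 * (c%:R - 2) / m + 10 * w / q + 15 * w / (q * (c%:R - 1)) +
     30 * C4_copies R E / (m ^+ 2 * (c%:R - 1)).
  apply: le_trans (num_variance C2 m1 q1 q2 w1 N0 erefl erefl).
  apply: ler_wpM2l; first by lra.
  pose LH (x : Om) := \sum_i \sum_k coef2 c b i k * cmatch R i k x +
    \sum_i \sum_k \sum_j cherry b i k j * degen3 R i k j x.
  have -> : mean (fun x : Om => (1 - carre_du_champ (fun j x => s^-1 * in_sum b j x)
    (fun x => s^-1 * edge_sum b x) x) ^+ 2) =
    (2 * v * m) ^- 2 * mean (fun x : Om => LH x ^+ 2).
    rewrite -meanZ; apply: eq_mean => x.
    have -> : carre_du_champ (fun j x => s^-1 * in_sum b j x) (fun x => s^-1 * edge_sum b x) x =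
      (2 * v * m)^-1 * (2 * v * m + LH x).
      rewrite /LH -(carre_du_champ_expand c0 hb2 hbb hsum) /carre_du_champ mulr_sumr mulr_sumr;
        apply: eq_bigr => j _.
      have -> : \sum_u (s^-1 * in_sum b j x - s^-1 * in_sum b j (recolor x j u)) *
        (s^-1 * edge_sum b x - s^-1 * edge_sum b (recolor x j u)) =
        s ^- 2 * \sum_u (in_sum b j x - in_sum b j (recolor x j u)) *
          (edge_sum b x - edge_sum b (recolor x j u)).
        by rewrite [RHS]mulr_sumr; apply: eq_bigr => u _; field.
      have -> : 2 * v * m = 2 * s ^+ 2 by rewrite s2; ring.
      by field; rewrite sn0 pnatr_eq0 -lt0n c0.
    field; rewrite !gt_eqF //.
  apply: ler_wpM2l; first by rewrite invr_ge0 sqr_ge0.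
  have := mean_carre_parts c0 hb2 hbb hsum hr.
  by rewrite C4_hom_orient.
move=> H; apply: le_trans H _; apply: lerD.
  rewrite (mulrC (5 / 4)) -[X in X <= _]mulrA; apply: ler_wpM2l; first exact: sqrtr_ge0.
  apply: le_trans (ler_wsqrtr HV); rewrite [Num.sqrt (25 / 16 * _)]sqrtrM; last by lra.
  apply: ler_wpM2r; first exact: sqrtr_ge0.
  have -> : 25 / 16 = (5 / 4) ^+ 2 :> R by field.
  by rewrite sqrtr_sqr ler_norm.
rewrite -sqrtrM //; apply: le_trans (ler_wsqrtr HM).
rewrite sqrtrM ?invr_ge0 // mulrA; apply: ler_wpM2r; first exact: sqrtr_ge0.
have -> : 4^-1 = (2^-1) ^+ 2 :> R by field.
rewrite sqrtr_sqr ger0_norm ?invr_ge0 //; lra.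
Qed.
End uniform_bound.

Theorem theorem1p8 (R : realType) (n : nat) (E : {set {set 'I_n}})
    (hE : simple_edges E) (m : nat) (hm : m = #|E|) (m_ge1 : (1 <= m)%N)
    (c : nat) (c_ge2 : (2 <= c)%N)
    (d : measure_display) (T : measurableType d) (P : probability T R)
    (X : 'I_n -> {RV P >-> nat})
    (X_indep : mutually_independent X)
    (X_unif : forall i, uniform_on_1_to c (X i))
    (F : T -> R)
    (hF : F = standardize P (monochromatic_edges R E X))
    (d' : measure_display) (T' : measurableType d') (Q : probability T' R)
    (Z : {RV Q >-> R}) (hZ : standard_normal Z) :
  (wasserstein P Q F Z <=
   (Num.sqrt (2 / pi) *
      Num.sqrt (3 * (c%:R - 2) / m%:R
                + 10 * Num.sqrt 2 / Num.sqrt m%:R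
                + 15 * Num.sqrt 2 / (Num.sqrt m%:R * (c%:R - 1))
                + 30 * C4_copies R E / (m%:R ^+ 2 * (c%:R - 1)))
    + Num.sqrt 2 *
      Num.sqrt ((c%:R - 1) / m%:R
                + 5 * Num.sqrt 2 / (Num.sqrt m%:R * (c%:R - 1))
                + 7 * Num.sqrt 2 / Num.sqrt m%:R))%:E)%E.
Proof.
rewrite {m}hm in m_ge1 *.
have c0 : (0 < c)%N by exact: leq_trans c_ge2.
pose mo (y : 'I_n -> nat) : R := monochromatic_edges R E (fun i (_ : unit) => y i) tt.
pose b := orient R E.
have moE w (x : {ffun 'I_n -> 'I_c}) : (forall i, X i w = (x i).+1) ->
  monochromatic_edges R E X w = edge_sum b x + #|E|%:R * c%:R^-1.
  move=> H; rewrite -monochromatic_edge_sum //; apply: eq_bigr => i _; apply: eq_bigr => j _.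
  by rewrite !H.
have expE (g : R -> R) (k : {ffun 'I_n -> 'I_c} -> R) :
  (forall x, g (edge_sum b x + #|E|%:R * c%:R^-1) = k x) ->
   'E_P[fun w => g (monochromatic_edges R E X w)]%E = (mean k)%:E.
  move=> H; apply: (expectation_mean X_indep X_unif c0).
    exact: (measurable_fun_countable X (fun y => g (mo y))).
  by move=> w x Hx; rewrite (moE _ _ Hx) H.
have EY : 'E_P[monochromatic_edges R E X]%E = (#|E|%:R * c%:R^-1)%:E.
  have -> := expE id (fun x => edge_sum b x + #|E|%:R * c%:R^-1) (fun=> erefl).
  by rewrite meanD mean_edge_sum // mean_cst // add0r.
have VY : 'V_P[monochromatic_edges R E X]%E = (vmatch R c * #|E|%:R)%:E.
  rewrite /variance unlock EY /= -(mean_edge_sum_sqr R hE c_ge2).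
  by apply: (expE (fun t => (t - #|E|%:R * c%:R^-1) * (t - #|E|%:R * c%:R^-1))) => x;
    rewrite addrK expr2.
pose s := Num.sqrt (vmatch R c * #|E|%:R).
have FE w : F w = s^-1 * (monochromatic_edges R E X w - #|E|%:R * c%:R^-1).
  by rewrite hF /standardize EY VY /= mulrC.
apply: ge_ereal_sup => _ [h hlip <-].
have H x y : `|h x - h y| <= `|x - y|.
  by have := hlip (x, y); rewrite /= mul1r; apply.
have [f [f' [Df Sf bf lf]]] := stein_solution H.
rewrite (expectation_std_normal hZ H).
have -> : 'E_P[h \o F]%E = (mean (fun x : {ffun 'I_n -> 'I_c} => h (s^-1 * edge_sum b x)))%:E.
  rewrite -(expE (fun t => h (s^-1 * (t - #|E|%:R * c%:R^-1)))); last by move=> x; rewrite addrK.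
  by congr expectation; apply/funext => w /=; rewrite FE.
rewrite -EFinB abse_EFin lee_fin.
have := discrete_bound hE c_ge2 m_ge1 Df bf lf (erefl s); rewrite -/b.
have -> // : mean (fun x : {ffun 'I_n -> 'I_c} =>
  f' (s^-1 * edge_sum b x) - s^-1 * edge_sum b x * f (s^-1 * edge_sum b x)) =
  mean (fun x : {ffun 'I_n -> 'I_c} => h (s^-1 * edge_sum b x)) - \int[lebesgue_measure]_t
    (h t * phi t).
rewrite -[X in _ = _ - X](mean_cst n c0) -meanN -meanD; apply: eq_mean => x.
by rewrite Sf.
Qed.
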